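(* Let $m\ge 1$ be an integer, let $\psi_{\alpha,N}$ be the degree $N$ Gaussian random SU($m+1$) polynomial on $\mathbb{C}^m$, $$\psi_{\alpha,N}(z)=\sum_{|j|=0}^{N}\alpha_j\sqrt{\binom{N}{j}}\,z^j ,$$ where the $\alpha_j$ are independent identically distributed standard complex Gaussian random variables, and for $r>0$ let $$\mathrm{Hole}_{N,r}=\{\alpha:\ \forall z\in B(0,r),\ \psi_{\alpha,N}(z)\ne 0\}.$$ Then for every $r>0$ there exist $c_{1,r,m}>0$, $c_{2,r,m}>0$ and $N_{r,m}$ such that for all $N>N_{r,m}$ $$e^{-c_{2,r,m}N^{m+1}}\le \mathrm{Prob}(\mathrm{Hole}_{N,r})\le e^{-c_{1,r,m}N^{m+1}}.$$
   Context: Multi-index notation: $j=(j_1,\dots,j_m)$ with $j_k\ge 0$ integers, $|j|=\sum_k j_k\le N$, $z^j=z_1^{j_1}\cdots z_m^{j_m}$, and $\binom{N}{j}=\frac{N!}{(N-|j|)!\,j_1!\cdots j_m!}$. A standard complex Gaussian random variable has mean $0$ and variance $1$, i.e. density $\pi^{-1}e^{-|w|^2}$ on $\mathbb{C}$. $B(0,r)=\{z\in\mathbb{C}^m:|z|<r\}$ with the Euclidean norm. *)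

(* Defs.v *)
From HB Require Import structures.
From mathcomp Require Import all_boot all_order all_algebra.
From mathcomp Require Import complex.
From mathcomp Require Import all_classical all_reals all_analysis.
Import Order.TTheory GRing.Theory Num.Theory.

Set Implicit Arguments.
Unset Strict Implicit.
Unset Printing Implicit Defensive.

Local Open Scope classical_set_scope.
Local Open Scope ring_scope.
Local Open Scope complex_scope.

(* Every multi-index with |j| <= N has all its entries in {0, ..., N}, so
   bounding the entries loses nothing and makes the index set a finType. *)
Definition multiindex (m N : nat) : Type :=
  {j : {ffun 'I_m -> 'I_N.+1} | (\sum_(k < m) j k <= N)%N}.

Definition mexp (m N : nat) (j : multiindex m N) (k : 'I_m) : nat := val j k.

Definition mdeg (m N : nat) (j : multiindex m N) : nat :=
  (\sum_(k < m) mexp j k)%N.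

Definition mbinom (R : realType) (m N : nat) (j : multiindex m N) : R :=
  N`!%:R / ((N - mdeg j)`! * \prod_(k < m) (mexp j k)`!)%:R.

Definition monomial_at (R : realType) (m N : nat) (j : multiindex m N)
    (z : 'rV[R[i]]_m) : R[i] :=
  \prod_(k < m) z 0 k ^+ mexp j k.

(* The norms carried by the library on 'rV are sup norms. *)
Definition eucl_norm (R : realType) (m : nat) (z : 'rV[R[i]]_m) : R :=
  Num.sqrt (\sum_(k < m) Normc.normc (z 0 k) ^+ 2).

Definition eucl_ball (R : realType) (m : nat) (r : R) : set 'rV[R[i]]_m :=
  [set z | eucl_norm z < r].

(* C carries the Borel sigma-algebra and the Lebesgue measure of R x R through
   the identification of w with (Re w, Im w). *)
Definition complex_pair (R : realType) (w : R[i])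
    : measurableTypeR R * measurableTypeR R :=
  (complex.Re w, complex.Im w).

Definition pair_complex (R : realType)
    (u : measurableTypeR R * measurableTypeR R) : R[i] := u.1 +i* u.2.

Definition complex_gaussian_pdf (R : realType) (w : R[i]) : R :=
  pi^-1 * expR (- (Normc.normc w ^+ 2)).

Definition standard_complex_gaussian (R : realType) (d : measure_display)
    (T : measurableType d) (P : probability T R) (X : T -> R[i]) : Prop :=
  measurable_fun setT (@complex_pair R \o X) /\
  forall B : set (measurableTypeR R * measurableTypeR R), measurable B ->
    P ((@complex_pair R \o X) @^-1` B) =
    (\int[(@lebesgue_measure R) \x (@lebesgue_measure R)]_(u in B)
       (complex_gaussian_pdf (pair_complex u))%:E)%E.

Definition mutually_independent (R : realType) (d d' : measure_display)
    (T : measurableType d) (T' : measurableType d') (P : probability T R)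
    (I : finType) (X : I -> T -> T') : Prop :=
  forall (J : {set I}) (B : I -> set T'), (forall i, measurable (B i)) ->
    P (\bigcap_(i in [set` J]) (X i @^-1` B i)) =
    (\prod_(i in J) P (X i @^-1` B i))%E.

Definition iid_standard_complex_gaussian (R : realType) (d : measure_display)
    (T : measurableType d) (P : probability T R) (I : finType)
    (alpha : I -> T -> R[i]) : Prop :=
  (forall j, standard_complex_gaussian P (alpha j)) /\
  mutually_independent P (fun j => @complex_pair R \o alpha j).

Definition su_polynomial (R : realType) (m N : nat)
    (a : multiindex m N -> R[i]) (z : 'rV[R[i]]_m) : R[i] :=
  \sum_(j : multiindex m N)
    a j * (Num.sqrt (mbinom R j))%:C * monomial_at j z.

Definition hole (R : realType) (m N : nat) (T : Type)
    (alpha : multiindex m N -> T -> R[i]) (r : R) : set T :=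
  [set w | forall z, eucl_ball r z ->
     su_polynomial (fun j => alpha j w) z != 0].

(* Main.v *)
Require Import Defs.
From HB Require Import structures.
From mathcomp Require Import all_boot all_order all_algebra all_solvable all_field.
From mathcomp Require Import complex.
From mathcomp Require Import all_classical all_reals all_analysis.
From mathcomp Require Import measurable_realfun.
From mathcomp Require Import ring lra zify.

(** The lower bound is a direct event: the constant coefficient is of size one
    and all the others are smaller than [exp (- C N)], so that the constant
    term dominates the polynomial on the ball.  There are at most [(2 N)^m]
    coefficients and each constraint has probability at least [exp (- C' N)].

    For the upper bound, let [f] be the random polynomial and suppose that it
    has no zero in the ball of radius [r].  On a complex line through the
    ball, [f] is a product of at most [N] linear factors whose zeros are far
    away.  This has two elementary consequences.
    - [poly_prod_roots_unity]: the product of [|f|] over the vertices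
      [w (s, .., s)], with [w ^ n = 1], of a regular polygon is at most
      [2^N |f 0|^n].  It is the mean value property of [log |f|].
    - [poly_growth_no_zero]: moving by [delta] inside the ball changes
      [log |f|] by [O (delta N)] only.  It plays the role of Harnack's
      inequality.
    Since [f 0] is a single Gaussian coefficient, [|f 0| <= exp (c N / 3)]
    outside an event of doubly exponentially small probability.  Choosing the
    constant [n] large and [delta] small, some vertex [w (s, .., s)] is then
    the centre of a polydisc of fixed radius [delta] on which
    [|f| <= exp (c N)]; this is [hole_forces_small_polydisc].

    It remains to see that, for one fixed centre, this has probability
    [exp (- c' N^(m+1))].  Consider the Taylor coefficients of
    [z^(- L) f (z)] at the centre with exponents [k] in [{0, .., K - 1}^m],
    where [L] and [K] are small multiples of [N].  They are small when [f] is
    small on the polydisc.  On the other hand [z^(L + l)] contributes to the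
    [k]-th coefficient only if [l >= k] in every entry, so they are
    triangular in the variables [alpha_(L + k)]; the diagonal entries are
    essentially the square roots of multinomial coefficients, exponentially
    large enough to outweigh both [exp (c N)] and the division by [z^L].  By
    independence each of these [K^m] conditions has conditional probability at
    most [exp (- L)]; this is the use of [small_ball_triangular].  Averages
    over the [K]-th roots of unity take the place of Taylor coefficients: on
    the monomials [z^(L + l)] with [l] in [{0, .., K - 1}^m] both agree up to
    scaling, and no contour integral occurs.

    Finally, probabilities of the hole can be compared with those of other
    events only because the hole is measurable, [measurable_hole]. *)

Import Order.TTheory GRing.Theory Num.Theory.
Import numFieldNormedType.Exports.
Import Normc.
Local Open Scope ring_scope.
Local Open Scope complex_scope.

Set Implicit Arguments.
Unset Strict Implicit.
Unset Printing Implicit Defensive.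

(** * The modulus of a complex number *)

Lemma normc_ge0 (R : rcfType) (x : R[i]) : 0 <= normc x.
Proof. by case: x => a b; exact: sqrtr_ge0. Qed.

Lemma ler_normcD (R : rcfType) (x y : R[i]) : normc (x + y) <= normc x + normc y.
Proof. exact: le_normcD. Qed.

Lemma normc_opp (R : rcfType) (x : R[i]) : normc (- x) = normc x.
Proof. exact: normcN. Qed.

Lemma ler_normcB (R : rcfType) (x y : R[i]) : normc (x - y) <= normc x + normc y.
Proof. by rewrite -(normc_opp y) ler_normcD. Qed.

Lemma normc_gt0 (R : rcfType) (x : R[i]) : (0 < normc x) = (x != 0).
Proof.
rewrite lt0r normc_ge0 andbT; apply/idP/idP; apply: contra => /eqP.
  by move=> ->; rewrite normc0.
by move/eq0_normc ->.
Qed.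

Lemma normcX (R : rcfType) (x : R[i]) n : normc (x ^+ n) = normc x ^+ n.
Proof.
by elim: n => [|n IH]; rewrite ?expr0 ?normc1// !exprS normcM IH.
Qed.

Lemma normc_prod (R : rcfType) (I : Type) (s : seq I) (P : pred I)
  (F : I -> R[i]) :
  normc (\prod_(i <- s | P i) F i) = \prod_(i <- s | P i) normc (F i).
Proof. exact: (big_morph _ (@normcM R) (@normc1 R)). Qed.

Lemma ler_normc_sum (R : rcfType) (I : Type) (s : seq I) (P : pred I)
  (F : I -> R[i]) :
  normc (\sum_(i <- s | P i) F i) <= \sum_(i <- s | P i) normc (F i).
Proof.
apply: (big_ind2 (fun x y => normc x <= y)); rewrite ?normc0// => x1 x2 y1 y2 h1 h2.
by apply: le_trans (ler_normcD _ _) _; exact: lerD.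
Qed.

Lemma normc_real (R : rcfType) (x : R) : normc x%:C = `|x|.
Proof. by rewrite /= expr0n/= addr0 sqrtr_sqr. Qed.

Lemma normc_Re (R : rcfType) (x : R[i]) : `|complex.Re x| <= normc x.
Proof.
by case: x => a b /=; rewrite -(sqrtr_sqr a) ler_sqrt ?addr_ge0 ?sqr_ge0// lerDl sqr_ge0.
Qed.

Lemma normc_Im (R : rcfType) (x : R[i]) : `|complex.Im x| <= normc x.
Proof.
by case: x => a b /=; rewrite -(sqrtr_sqr b) ler_sqrt ?addr_ge0 ?sqr_ge0// lerDr sqr_ge0.
Qed.

Lemma normc_le_ReIm (R : rcfType) (x : R[i]) :
  normc x <= `|complex.Re x| + `|complex.Im x|.
Proof.
case: x => a b /=.
have h : 0 <= `|a| + `|b| by rewrite addr_ge0.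
rewrite -[leRHS]ger0_norm// -(sqrtr_sqr (_ + _)) ler_sqrt ?sqr_ge0// sqrrD.
rewrite !real_normK ?num_real//.
by rewrite addrAC lerDl mulrn_wge0// mulr_ge0.
Qed.

(** * Polynomials without zeros in a disc *)

Lemma normc_root1 (R : rcfType) (w : R[i]) n : (0 < n)%N -> w ^+ n = 1 ->
  normc w = 1.
Proof.
move=> n0 wn; apply/eqP; rewrite -(pexpr_eq1 n0 (normc_ge0 w)).
by rewrite -normcX wn normc1.
Qed.

Lemma normc_horner_factored (R : rcfType) (p : {poly R[i]}) :
  {rs : seq R[i] | [/\ forall t, normc p.[t] =
      normc (lead_coef p) * \prod_(z <- rs) normc (t - z),
      p != 0 -> (size rs < size p)%N & p != 0 -> forall z, z \in rs -> root p z]}.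
Proof.
have [rs Dp] := closed_field_poly_normal p; exists rs; split => [t|p0|p0 z zrs].
- by rewrite {1}Dp hornerZ normcM horner_prod normc_prod; congr (_ * _);
     apply: eq_bigr => z _; rewrite hornerXsubC.
- by rewrite [in ltnRHS]Dp size_scale ?lead_coef_eq0// size_prod_XsubC.
- by rewrite Dp rootZ ?lead_coef_eq0// root_prod_XsubC.
Qed.

(** All zeros [z] satisfy [|z| >= s], so each factor obeys
    [|t - z| <= |z| (1 + |t| / s)], and there are at most [N] of them. *)
Lemma poly_growth_no_zero (R : rcfType) (p : {poly R[i]}) (N : nat) (s : R)
    (t : R[i]) :
  (size p <= N.+1)%N -> 0 < s -> (forall z, normc z < s -> ~~ root p z) ->
  normc p.[t] <= normc p.[0] * (1 + normc t / s) ^+ N.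
Proof.
move=> szp s0 nz.
have p0 : p != 0.
  by apply: contra (nz 0 _); [move=> /eqP->; rewrite root0 | rewrite normc0].
have [rs [Hp /(_ p0) szrs /(_ p0) rrs]] := normc_horner_factored p.
have ge1 : 1 <= 1 + normc t / s by rewrite lerDl divr_ge0 ?normc_ge0 ?ltW.
rewrite !Hp -mulrA ler_wpM2l ?normc_ge0//.
apply: (@le_trans _ _ (\prod_(z <- rs) (normc (0 - z) * (1 + normc t / s)))).
  rewrite big_seq [leRHS]big_seq; apply: ler_prod => z zrs; rewrite normc_ge0/=.
  have hz : s <= normc z by rewrite leNgt; apply/negP => /nz; rewrite rrs.
  apply: le_trans (ler_normcB _ _) _.
  rewrite sub0r normc_opp mulrDr mulr1 addrC lerD2l mulrCA.
  by rewrite ler_peMr ?normc_ge0// ler_pdivlMr// mul1r.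
rewrite big_split/= ler_wpM2l//; first by apply: prodr_ge0 => z _; exact: normc_ge0.
rewrite big_const_seq count_predT iter_mulr_1.
by rewrite ler_weXn2l//; move: (leq_trans szrs szp).
Qed.

Lemma roots_unity_size (R : rcfType) n (ws : seq R[i]) : (0 < n)%N ->
  'X^n - 1 = \prod_(w <- ws) ('X - w%:P) -> size ws = n.
Proof.
move=> n0 Dws; apply: succn_inj.
by rewrite -(size_prod_XsubC ws id) -Dws -polyC1 size_XnsubC.
Qed.

Lemma roots_unity_normc (R : rcfType) n (ws : seq R[i]) w : (0 < n)%N ->
  'X^n - 1 = \prod_(w <- ws) ('X - w%:P) -> w \in ws -> normc w = 1.
Proof.
move=> n0 Dws wws; apply: (normc_root1 n0); apply/eqP; rewrite -subr_eq0.
have := root_prod_XsubC ws w; rewrite wws -Dws rootE !hornerE.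
by move=> ->.
Qed.

(** For each zero [z], the product of [|w - z|] over the [n]-th roots of
    unity is [|z^n - 1|], at most [2 |z|^n] because [|z| >= 1].  In terms of
    [log |p|], the mean over the regular [n]-gon exceeds the value at the
    centre by at most [N log 2 / n]. *)
Lemma poly_prod_roots_unity (R : rcfType) (p : {poly R[i]}) (N n : nat)
    (ws : seq R[i]) :
  (size p <= N.+1)%N -> (forall z, normc z < 1 -> ~~ root p z) ->
  'X^n - 1 = \prod_(w <- ws) ('X - w%:P) -> (0 < n)%N ->
  \prod_(w <- ws) normc p.[w] <= 2 ^+ N * normc p.[0] ^+ n.
Proof.
move=> szp nz Dws n0.
have szws := roots_unity_size n0 Dws.
have p0 : p != 0.
  by apply: contra (nz 0 _); [move=> /eqP->; rewrite root0 | rewrite normc0].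
have [rs [Hp /(_ p0) szrs /(_ p0) rrs]] := normc_horner_factored p.
under eq_bigr do rewrite Hp.
rewrite big_split/= big_const_seq count_predT iter_mulr_1 szws Hp exprMn.
rewrite mulrCA ler_wpM2l ?exprn_ge0 ?normc_ge0// exchange_big/=.
have Hprod z : \prod_(w <- ws) normc (w - z) = normc (z ^+ n - 1).
  have -> : z ^+ n - 1 = ('X^n - 1).[z] by rewrite !hornerE.
  rewrite Dws horner_prod normc_prod.
  by apply: eq_bigr => w _; rewrite hornerXsubC -normc_opp opprB.
apply: (@le_trans _ _ (\prod_(z <- rs) (2 * normc (0 - z) ^+ n))).
  rewrite big_seq [leRHS]big_seq; apply: ler_prod => z zrs.
  rewrite Hprod normc_ge0/= sub0r normc_opp.
  have hz : 1 <= normc z by rewrite leNgt; apply/negP => /nz; rewrite rrs.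
  apply: le_trans (ler_normcB _ _) _; rewrite normc1 normcX mulr_natl mulr2n.
  by rewrite lerD2l exprn_ege1.
rewrite big_split/= -[X in _ <= _ * X]prodrXl ler_wpM2r//.
  by apply: prodr_ge0 => z _; rewrite exprn_ge0 ?normc_ge0.
rewrite big_const_seq count_predT iter_mulr_1.
by rewrite ler_weXn2l ?ler1n//; move: (leq_trans szrs szp).
Qed.

Lemma roots_unity_exist (R : rcfType) n : (0 < n)%N ->
  {ws : seq R[i] | 'X^n - 1 = \prod_(w <- ws) ('X - w%:P)}.
Proof.
move=> n0; have [ws Dp] := closed_field_poly_normal ('X^n - 1 : {poly R[i]}).
by exists ws; rewrite {1}Dp -polyC1 (monicP _) ?monicXnsubC// scale1r.
Qed.

(** * Taylor coefficients by averaging over roots of unity *)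

Lemma prim_root_exists (R : rcfType) n : (0 < n)%N ->
  {z : R[i] | n.-primitive_root z}.
Proof.
move=> n0; have [ws Dp] := roots_unity_exist R n0; apply/sigW.
have rn1 : all n.-unity_root ws.
  by apply/allP => z; rewrite -root_prod_XsubC -Dp -polyC1.
have sz_ws : (n < (size ws).+1)%N.
  by rewrite -(size_prod_XsubC ws id) -Dp -polyC1 size_XnsubC.
have [|z] := hasP (has_prim_root n0 rn1 _ sz_ws); last by exists z.
by rewrite -separable_prod_XsubC -Dp separable_Xn_sub_1 // pnatr_eq0 -lt0n.
Qed.

Lemma sum_prim_root_expr (R : rcfType) K (om : R[i]) a :
  K.-primitive_root om ->
  \sum_(i < K) (om ^+ a) ^+ i = if (K %| a)%N then K%:R else 0.
Proof.
move=> pr; case: ifPn => [Ka|nKa].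
  have -> : om ^+ a = 1 by apply/eqP; rewrite -(prim_order_dvd pr).
  by under eq_bigr do rewrite expr1n; rewrite sumr_const card_ord.
have h : om ^+ a - 1 != 0 by rewrite subr_eq0 -(prim_order_dvd pr).
apply: (mulfI h); rewrite mulr0 -subrX1 -exprM mulnC exprM.
by rewrite (prim_expr_order pr) expr1n subrr.
Qed.

(** In the binomial expansion of [(s + d om^i)^l], averaging against
    [om^(- i k)] keeps the exponents congruent to [k] modulo [K]; for [l < K]
    this is the exponent [k] alone. *)
Lemma discrete_cauchy (R : rcfType) K (om s d : R[i]) k l :
  K.-primitive_root om -> (k < K)%N -> (l < K)%N ->
  K%:R^-1 * \sum_(i < K) (om ^- (i * k)) * (s + d * om ^+ i) ^+ l =
  if (k <= l)%N then s ^+ (l - k) * d ^+ k *+ 'C(l, k) else 0.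
Proof.
move=> pr kK lK.
have K0 : K%:R != 0 :> R[i] by rewrite pnatr_eq0; lia.
have om0 : om != 0 by rewrite (prim_root_eq0 pr); lia.
have omK : om ^+ K = 1 by exact: prim_expr_order.
apply: (mulfI K0); rewrite mulVKf//.
under eq_bigr => i _ do rewrite exprDn mulr_sumr.
rewrite exchange_big/=.
transitivity (\sum_(j < l.+1) (s ^+ (l - j) * d ^+ j *+ 'C(l, j)) *
   (if (j : nat) == k then K%:R else 0)).
  apply: eq_bigr => j _.
  transitivity ((s ^+ (l - j) * d ^+ j *+ 'C(l, j)) *
    \sum_(i < K) (om ^+ (j + (K - k))) ^+ i).
    rewrite mulr_sumr; apply: eq_bigr => i _.
    rewrite mulrnAl mulrnAr; congr (_ *+ _).
    have -> : om ^- (i * k) = om ^+ (i * (K - k)).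
      apply: (mulfI (expf_neq0 (i * k) om0)).
      rewrite divff ?expf_neq0// -exprD -mulnDr subnKC ?(ltnW kK)//.
      by rewrite mulnC exprM omK expr1n.
    have -> : (om ^+ (j + (K - k))) ^+ i = om ^+ (i * (K - k)) * (om ^+ i) ^+ j.
      by rewrite -!exprM -exprD mulnDl addnC (mulnC i) (mulnC i).
    by rewrite exprMn; ring.
  have -> := sum_prim_root_expr (j + (K - k)) pr.
  congr (_ * _); have -> // : (K %| j + (K - k))%N = (j == k :> nat).
  apply/idP/eqP => [|->]; last by rewrite subnKC ?dvdnn ?(ltnW kK).
  move=> /dvdnP[q hq]; have jl := ltn_ord j.
  have : (q < 2)%N by rewrite -(ltn_pmul2r (m := K)); lia.
  case: q hq => [|[|//]]; lia.
case: ifPn => kl.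
  rewrite (bigD1 (inord k))//= inordK ?ltnS// eqxx big1 ?addr0 1?mulrC// => j.
  by rewrite -val_eqE/= inordK ?ltnS// => /negbTE->; rewrite mulr0.
rewrite mulr0 big1// => j _; rewrite ifN ?mulr0//; have := ltn_ord j; lia.
Qed.

(** * Independence of a variable from a sigma-algebra *)

Lemma g_sigma_algebra_sub_measurable d (T : measurableType d)
    (G : set (set T)) :
  (G `<=` measurable -> <<s G >> `<=` (measurable : set (set T)))%classic.
Proof.
by move=> Gm; apply: smallest_sub => //; exact: sigma_algebra_measurable.
Qed.

(** The events satisfying the product rule with [X] form a Dynkin system. *)
Lemma pi_system_independence d d' (T : measurableType d)
    (T' : measurableType d') (R : realType) (P : probability T R)
    (G : set (set T)) (X : T -> T') :
  (G `<=` measurable)%classic -> setI_closed G -> measurable_fun setT X ->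
  (forall A B, G A -> measurable B ->
    P (A `&` X @^-1` B)%classic = (P A * P (X @^-1` B)%classic)%E) ->
  forall A B, <<s G >>%classic A -> measurable B ->
    P (A `&` X @^-1` B)%classic = (P A * P (X @^-1` B)%classic)%E.
Proof.
move=> Gm GI mX GX A B GA mB.
have mXB : measurable (X @^-1` B)%classic by rewrite -[X in measurable X]setTI; exact: mX.
have sGm := g_sigma_algebra_sub_measurable Gm.
pose Q := fun A : set (g_sigma_algebraType G) =>
  P (A `&` X @^-1` B)%classic = (P A * P (X @^-1` B)%classic)%E.
apply: (@dynkin_induction _ (g_sigma_algebraType G) G Q) => //; rewrite /Q.
- by rewrite setTI probability_setT mul1e.
- by move=> C GC; exact: GX.
- move=> S /sGm mS QS.
  rewrite setIC -setDE measureD//; last by rewrite ltey_eq fin_num_measure.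
  rewrite (setIC _ S) [X in (_ - X)%E](QS : P (S `&` X @^-1` B)%classic = _).
  rewrite probability_setC// muleBl ?mul1e ?fin_num_measure//.
- move=> F mF tF QF.
  rewrite setI_bigcupl measure_bigcup//; last 2 first.
  + by move=> i _; apply: measurableI => //; exact: sGm _ (mF i).
  + exact: trivIset_setIr.
  rewrite (measure_bigcup P) => //; last by move=> i _; exact: sGm _ (mF i).
  rewrite muleC -(fineK (fin_num_measure P _ mXB)) -nneseriesZl//.
  by apply: eq_eseriesr => i _; rewrite fineK ?fin_num_measure// muleC; exact: QF.
Qed.

(** The joint law of the sigma-algebra generated by [G] and of [X] is a
    product measure, so the event may be integrated first over [X] alone. *)
Lemma independent_section_bound d d' (T : measurableType d)
    (T' : measurableType d') (R : realType) (P : probability T R)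
    (G : set (set T)) (X : T -> T') (kappa : \bar R) (A : set T)
    (W : set (g_sigma_algebraType G * T')) :
  (G `<=` measurable)%classic -> setI_closed G -> measurable_fun setT X ->
  (forall A B, G A -> measurable B ->
    P (A `&` X @^-1` B)%classic = (P A * P (X @^-1` B)%classic)%E) ->
  <<s G >>%classic A -> measurable W -> (0 <= kappa)%E ->
  (forall w, A w -> (P (X @^-1` xsection W w)%classic <= kappa)%E) ->
  (P (A `&` [set w | W (w, X w)])%classic <= kappa * P A)%E.
Proof.
move=> Gm GI mX GX GA mW k0 HW.
have sGm := g_sigma_algebra_sub_measurable Gm.
have mid : measurable_fun setT (id : T -> g_sigma_algebraType G).
  by move=> _ B mB; rewrite setTI preimage_id; exact: sGm.
pose idG : {mfun T >-> g_sigma_algebraType G} := mfun_Sub (mem_set mid).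
pose X' : {mfun T >-> T'} := mfun_Sub (mem_set mX).
have mpr : measurable_fun setT (fun w : T => (w : g_sigma_algebraType G, X w)).
  by apply/measurable_fun_pairP; split.
pose pr : {mfun T >-> (g_sigma_algebraType G * T')%type} :=
  mfun_Sub (mem_set mpr).
pose W' := (W `&` (A `*` setT))%classic.
have mA : measurable (A : set (g_sigma_algebraType G)) by [].
have mW' : measurable W' by apply: measurableI => //; exact: measurableX.
have -> : (A `&` [set w | W (w, X w)] = pr @^-1` W')%classic.
  by apply/seteqP; split => w /=; rewrite /W' /=; tauto.
rewrite -[leLHS]/(distribution P pr W').
rewrite -(@product_measure_unique _ _ _ _ _ (distribution P idG)
  (distribution P X') (distribution P pr))//; last first.
  move=> C D mC mD; rewrite /distribution /pushforward /=.
  exact: (pi_system_independence Gm GI mX GX).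
rewrite /product_measure1.
apply: (@le_trans _ _ (\int[distribution P idG]_x (kappa * (\1_A x)%:E))%E).
  apply: ge0_le_integral => //.
  - exact: measurable_fun_xsection.
  - apply: emeasurable_funM => //; apply/measurable_EFinP.
    exact: measurable_indic.
  - move=> x _ /=; have [xA|xA] := boolP (x \in A).
      rewrite indicE xA mule1; apply: le_trans _ (HW x (set_mem xA)).
      apply: le_measure; rewrite ?inE.
      + exact: measurable_xsection.
      + exact: measurable_xsection.
      + by move=> y; rewrite /xsection/= !inE => -[].
    rewrite indicE (negbTE xA) mule0.
    rewrite (_ : xsection W' x = set0) ?measure0//.
    apply/seteqP; split => // y; rewrite /xsection/= inE => -[_ [/= Ax _]].
    by move: xA; rewrite notin_setE; exact.
rewrite ge0_integralZl//.
  by rewrite integral_indic// setIT.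
by apply/measurable_EFinP; exact: measurable_indic.
Qed.

(** * The standard complex Gaussian law *)

Lemma complex_gaussian_pdfE (R : realType)
    (u : measurableTypeR R * measurableTypeR R) :
  complex_gaussian_pdf (pair_complex u) = pi^-1 * expR (- (u.1 ^+ 2 + u.2 ^+ 2)).
Proof.
by rewrite /complex_gaussian_pdf /= sqr_sqrtr// addr_ge0// sqr_ge0.
Qed.

Lemma measurable_complex_gaussian_pdf (R : realType) :
  measurable_fun setT (fun u : measurableTypeR R * measurableTypeR R =>
    complex_gaussian_pdf (pair_complex u)).
Proof.
under eq_fun do rewrite complex_gaussian_pdfE.
apply: measurable_funM => //; apply: measurableT_comp => //.
apply: measurableT_comp => //; apply: measurable_funD;
  by apply: measurable_funX; (exact: measurable_fst || exact: measurable_snd).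
Qed.

Lemma complex_gaussian_pdf_ge0 (R : realType) (w : R[i]) :
  0 <= complex_gaussian_pdf w.
Proof. by rewrite mulr_ge0 ?expR_ge0// invr_ge0 pi_ge0. Qed.

Lemma lebesgue_box (R : realType) (a1 b1 a2 b2 : R) :
  a1 <= b1 -> a2 <= b2 ->
  ((@lebesgue_measure R) \x (@lebesgue_measure R))%E
    (`[a1, b1] `*` `[a2, b2])%classic = ((b1 - a1) * (b2 - a2))%:E.
Proof.
move=> h1 h2; rewrite product_measure1E//.
have E (a b : R) : a <= b -> lebesgue_measure `[a, b]%classic = (b - a)%:E.
  rewrite lebesgue_measure_itv/= lte_fin.
  by case: ltgtP => // -> _; rewrite subrr.
by rewrite [X in (X * _)%E](E _ _ h1) [X in (_ * X)%E](E _ _ h2).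
Qed.

Lemma gaussian_event_measurable (R : realType) d (T : measurableType d)
    (P : probability T R) (X : T -> R[i]) (B : set (measurableTypeR R * measurableTypeR R)) :
  standard_complex_gaussian P X -> measurable B ->
  measurable ((@complex_pair R \o X) @^-1` B)%classic.
Proof. by move=> [mX _] mB; rewrite -[X in measurable X]setTI; exact: mX. Qed.

Lemma gaussian_box_ge (R : realType) d (T : measurableType d)
    (P : probability T R) (X : T -> R[i]) (a1 b1 a2 b2 c : R) :
  standard_complex_gaussian P X -> a1 <= b1 -> a2 <= b2 -> 0 <= c ->
  (forall x y, a1 <= x <= b1 -> a2 <= y <= b2 ->
     c <= complex_gaussian_pdf (x +i* y)) ->
  ((c * ((b1 - a1) * (b2 - a2)))%:E <=
   P ((@complex_pair R \o X) @^-1` (`[a1, b1] `*` `[a2, b2]))%classic)%E.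
Proof.
move=> [mX HX] h1 h2 c0 hc.
have mB : measurable (`[a1, b1] `*` `[a2, b2] :
    set (measurableTypeR R * measurableTypeR R))%classic by exact: measurableX.
rewrite HX// EFinM -lebesgue_box// -integral_cst//.
apply: ge0_le_integral => //.
- apply/measurable_EFinP; apply: measurable_funTS.
  exact: measurable_complex_gaussian_pdf.
- move=> [x y] [/=]; rewrite !in_itv/= => hx hy.
  by rewrite lee_fin; exact: hc.
Qed.

(** The density is at most 1, and the disc lies in a square of area
    [4 t^2]. *)
Lemma gaussian_disc_le (R : realType) d (T : measurableType d)
    (P : probability T R) (X : T -> R[i]) (c : R[i]) (t : R)
    (B : set (measurableTypeR R * measurableTypeR R)) :
  standard_complex_gaussian P X -> 0 <= t -> measurable B ->
  (forall u, B u -> normc (pair_complex u - c) <= t) ->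
  (P ((@complex_pair R \o X) @^-1` B)%classic <= (4 * t ^+ 2)%:E)%E.
Proof.
move=> [mX HX] t0 mB hB; rewrite HX//.
case: c hB => c1 c2 hB.
pose Q := (`[c1 - t, c1 + t] `*` `[c2 - t, c2 + t] :
    set (measurableTypeR R * measurableTypeR R))%classic.
have mQ : measurable Q by exact: measurableX.
have BQ : (B `<=` Q)%classic.
  move=> [x y] /hB h; split; rewrite /= in_itv/= -ler_distlC distrC.
    by apply: le_trans h; exact: (normc_Re (pair_complex (x, y) - (c1 +i* c2))).
  by apply: le_trans h; exact: (normc_Im (pair_complex (x, y) - (c1 +i* c2))).
have mpdf : measurable_fun setT (fun u => (complex_gaussian_pdf (@pair_complex R u))%:E).
  by apply/measurable_EFinP; exact: measurable_complex_gaussian_pdf.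
apply: (@le_trans _ _ (\int[(@lebesgue_measure R) \x (@lebesgue_measure R)]_(u in Q)
       (complex_gaussian_pdf (pair_complex u))%:E)%E).
  apply: ge0_subset_integral => //; first exact: measurable_funTS.
  by move=> u _; rewrite lee_fin complex_gaussian_pdf_ge0.
apply: (@le_trans _ _ (\int[(@lebesgue_measure R) \x (@lebesgue_measure R)]_(u in Q)
       (cst 1%E u))%E).
  apply: ge0_le_integral => //.
  - by move=> u _; rewrite lee_fin complex_gaussian_pdf_ge0.
  - exact: measurable_funTS.
  - move=> u _; rewrite lee_fin /complex_gaussian_pdf.
    rewrite mulr_ile1 ?expR_ge0 ?invr_ge0 ?pi_ge0//.
      by rewrite invf_le1 ?pi_gt0// (le_trans _ (pi_ge2 R))// ler1n.
    by rewrite -expR0 ler_expR oppr_le0 sqr_ge0.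
have hQ : ((@lebesgue_measure R) \x (@lebesgue_measure R))%E Q =
    ((c1 + t - (c1 - t)) * (c2 + t - (c2 - t)))%:E by apply: lebesgue_box; lra.
by rewrite integral_cst// mul1e [leLHS]hQ lee_fin; lra.
Qed.

(** Half of the exponent [|w|^2] pays for the factor [exp (- s^2 / 2)]; the
    other half leaves a centred Gaussian weight of total mass 2. *)
Lemma gaussian_tail (R : realType) d (T : measurableType d)
    (P : probability T R) (X : T -> R[i]) (s : R) :
  standard_complex_gaussian P X -> 0 <= s ->
  (P [set w | (s <= normc (X w))%R]%classic <= (2 * expR (- (s ^+ 2 / 2)))%:E)%E.
Proof.
move=> [mX HX] s0.
pose B : set (measurableTypeR R * measurableTypeR R) :=
  [set u | s ^+ 2 <= u.1 ^+ 2 + u.2 ^+ 2]%classic.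
have msq : measurable_fun setT (fun u : measurableTypeR R * measurableTypeR R =>
    u.1 ^+ 2 + u.2 ^+ 2).
  apply: measurable_funD;
  by apply: measurable_funX; (exact: measurable_fst || exact: measurable_snd).
have mB : measurable B.
  rewrite (_ : B = (fun u => u.1 ^+ 2 + u.2 ^+ 2) @^-1` `[s ^+ 2, +oo[)%classic.
    by rewrite -[X in measurable X]setTI; exact: msq.
  by apply/seteqP; split => u /=; rewrite in_itv/= andbT.
have -> : [set w | (s <= normc (X w))%R]%classic = ((@complex_pair R \o X) @^-1` B)%classic.
  apply/seteqP; split => w; rewrite /B/=; case: (X w) => a b /=;
  rewrite -[_ <= _ + _](@ler_sqrt R) ?addr_ge0 ?sqr_ge0//; rewrite sqrtr_sqr ger0_norm//.
rewrite HX//.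
pose g (x : R) : R := normal_pdf 0 1 x.
have gE x : g x = (Num.sqrt (pi *+ 2))^-1 * expR (- (x ^+ 2 / 2)).
  by rewrite /g /normal_pdf oner_eq0 /normal_peak /normal_fun
    subr0 expr1n mul1r mulNr.
have g0 x : 0 <= g x by exact: normal_pdf_ge0.
have mg : measurable_fun setT g by exact: measurable_normal_pdf.
pose h (u : measurableTypeR R * measurableTypeR R) : \bar R :=
  ((2 * expR (- (s ^+ 2 / 2)))%:E * ((g u.1)%:E * (g u.2)%:E))%E.
have mgg : measurable_fun setT (fun u : measurableTypeR R * measurableTypeR R =>
   ((g u.1)%:E * (g u.2)%:E)%E).
  apply: emeasurable_funM; apply/measurable_EFinP; apply: (measurableT_comp mg).
    exact: measurable_fst.
  exact: measurable_snd.
have mh : measurable_fun setT h by exact: emeasurable_funM.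
have h0 u : (0 <= h u)%E.
  by rewrite !mule_ge0 ?lee_fin ?mulr_ge0 ?expR_ge0.
apply: (@le_trans _ _ (\int[(@lebesgue_measure R) \x (@lebesgue_measure R)]_(u in B) h u)%E).
  apply: ge0_le_integral => //.
  - by move=> u _; rewrite lee_fin complex_gaussian_pdf_ge0.
  - by apply/measurable_EFinP; apply: measurable_funTS; exact: measurable_complex_gaussian_pdf.
  - exact: measurable_funTS.
  move=> u Bu; rewrite complex_gaussian_pdfE /h -!EFinM lee_fin !gE.
  set p := Num.sqrt _.
  have -> : 2 * expR (- (s ^+ 2 / 2)) *
      (p^-1 * expR (- (u.1 ^+ 2 / 2)) * (p^-1 * expR (- (u.2 ^+ 2 / 2)))) =
    2 * (p ^+ 2)^-1 * (expR (- (s ^+ 2 / 2)) *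
      (expR (- (u.1 ^+ 2 / 2)) * expR (- (u.2 ^+ 2 / 2)))).
    by rewrite -exprVn; ring.
  have -> : 2 * (p ^+ 2)^-1 = pi^-1 :> R.
    have p0 : (0 : R) < pi by exact: pi_gt0.
    have -> : p ^+ 2 = pi *+ 2 by rewrite /p sqr_sqrtr// mulrn_wge0// ltW.
    by move: (lt0r_neq0 p0); move: pi => q q0; field.
  rewrite ler_wpM2l ?invr_ge0 ?pi_ge0// -!expRD ler_expR.
  by move: Bu; rewrite /B /=; lra.
apply: (@le_trans _ _ (\int[(@lebesgue_measure R) \x (@lebesgue_measure R)]_u h u)%E).
  by apply: ge0_subset_integral.
rewrite /h ge0_integralZl//; last first.
- by move=> u _; rewrite mule_ge0 ?lee_fin.
rewrite fubini_tonelli1//; last by move=> u; rewrite mule_ge0 ?lee_fin.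
rewrite (_ : (\int[_]_x _ = 1)%E) ?mule1//.
rewrite -[RHS](@integral_normal_pdf R 0 1) ?oner_eq0//.
apply: eq_integral => x _; rewrite /fubini_F/= ge0_integralZl ?lee_fin//.
- by rewrite /g integral_normal_pdf ?oner_eq0// mule1.
- by apply/measurable_EFinP.
- by move=> y _; rewrite lee_fin.
Qed.

(** * Measurable complex-valued functions *)

Definition cmeasurable (R : realType) d (T : measurableType d) (f : T -> R[i]) :=
  measurable_fun setT (@complex_pair R \o f).

Lemma cmeasurableP (R : realType) d (T : measurableType d) (f : T -> R[i]) :
  cmeasurable f <->
  (measurable_fun setT (fun w => complex.Re (f w) : measurableTypeR R) /\
   measurable_fun setT (fun w => complex.Im (f w) : measurableTypeR R)).
Proof. exact: measurable_fun_pairP. Qed.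

Lemma cmeasurable_cst (R : realType) d (T : measurableType d) (c : R[i]) :
  cmeasurable (fun _ : T => c).
Proof. exact: measurable_cst. Qed.

Lemma cmeasurableD (R : realType) d (T : measurableType d) (f g : T -> R[i]) :
  cmeasurable f -> cmeasurable g -> cmeasurable (fun w => f w + g w).
Proof.
move=> /cmeasurableP[fr fi] /cmeasurableP[gr gi]; apply/cmeasurableP; split.
- rewrite (_ : (fun _ => _) = fun w => complex.Re (f w) + complex.Re (g w)).
    exact: measurable_funD.
  by apply/funext => w; case: (f w) (g w) => [? ?] [? ?].
- rewrite (_ : (fun _ => _) = fun w => complex.Im (f w) + complex.Im (g w)).
    exact: measurable_funD.
  by apply/funext => w; case: (f w) (g w) => [? ?] [? ?].
Qed.

Lemma cmeasurableM (R : realType) d (T : measurableType d) (f g : T -> R[i]) :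
  cmeasurable f -> cmeasurable g -> cmeasurable (fun w => f w * g w).
Proof.
move=> /cmeasurableP[fr fi] /cmeasurableP[gr gi]; apply/cmeasurableP; split.
- rewrite (_ : (fun _ => _) = fun w => complex.Re (f w) * complex.Re (g w) -
      complex.Im (f w) * complex.Im (g w)).
    by apply: measurable_funB; exact: measurable_funM.
  by apply/funext => w; case: (f w) (g w) => [? ?] [? ?].
- rewrite (_ : (fun _ => _) = fun w => complex.Re (f w) * complex.Im (g w) +
      complex.Im (f w) * complex.Re (g w)).
    by apply: measurable_funD; exact: measurable_funM.
  by apply/funext => w; case: (f w) (g w) => [? ?] [? ?].
Qed.

Lemma cmeasurable_sum (R : realType) d (T : measurableType d) (I : Type)
    (s : seq I) (f : I -> T -> R[i]) :
  (forall i, cmeasurable (f i)) -> cmeasurable (fun w => \sum_(i <- s) f i w).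
Proof.
move=> mf; elim: s => [|i s IH].
  by under eq_fun do rewrite big_nil; exact: cmeasurable_cst.
by under eq_fun do rewrite big_cons; exact: cmeasurableD.
Qed.

Definition sqnorm (R : realType) (w : R[i]) : R :=
  complex.Re w ^+ 2 + complex.Im w ^+ 2.

Lemma sqnorm_ge0 (R : realType) (w : R[i]) : 0 <= sqnorm w.
Proof. by rewrite addr_ge0 ?sqr_ge0. Qed.

Lemma sqnorm_eq0 (R : realType) (w : R[i]) : (sqnorm w == 0) = (w == 0).
Proof.
by case: w => a b; rewrite /sqnorm /= paddr_eq0 ?sqr_ge0// !sqrf_eq0 eq_complex.
Qed.

Lemma measurable_sqnorm (R : realType) d (T : measurableType d) (f : T -> R[i]) :
  cmeasurable f ->
  measurable_fun setT (fun w => sqnorm (f w)).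
Proof.
by move=> /cmeasurableP[fr fi]; apply: measurable_funD; exact: measurable_funX.
Qed.

Lemma cmeasurable_normc_le (R : realType) d (T : measurableType d)
    (f : T -> R[i]) (t : R) :
  cmeasurable f -> measurable [set w | normc (f w) <= t]%classic.
Proof.
move=> mf; have [t0|t0] := leP 0 t; last first.
  rewrite (_ : [set _ | _]%classic = set0) //; apply/seteqP; split => w //=.
  by rewrite leNgt (lt_le_trans t0) ?normc_ge0.
rewrite (_ : [set _ | _]%classic =
  (fun w => sqnorm (f w)) @^-1` `]-oo, t ^+ 2])%classic.
  by rewrite -[X in measurable X]setTI; exact: measurable_sqnorm.
apply/seteqP; split => w /=; rewrite in_itv/= /sqnorm; case: (f w) => a b /=;
by rewrite -[_ + _ <= _](@ler_sqrt R) ?sqr_ge0// sqrtr_sqr ger0_norm.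
Qed.

(** * Small ball estimate for triangular linear forms *)

(** A pi-system generating the sigma-algebra of all the variables other than
    [alpha j0]; a variable is left unconstrained by taking [B i = setT]. *)
Definition cylinders_off (R : realType) (T : Type) (I : finType)
    (alpha : I -> T -> R[i]) (j0 : I) : set (set T) :=
  [set A | exists2 B : I -> set (measurableTypeR R * measurableTypeR R),
    forall i, measurable (B i) &
    A = \bigcap_(i in [set` ~: [set j0]])
          ((@complex_pair R \o alpha i) @^-1` B i)]%classic.

Lemma cylinders_off_setI (R : realType) (T : Type) (I : finType)
    (alpha : I -> T -> R[i]) (j0 : I) : setI_closed (cylinders_off alpha j0).
Proof.
move=> _ _ [B mB ->] [C mC ->]; exists (fun i => B i `&` C i)%classic.
  by move=> i; exact: measurableI.
rewrite -bigcapI; apply: eq_bigcapr => i _.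
by rewrite preimage_setI.
Qed.

Lemma cylinders_off_measurable (R : realType) d (T : measurableType d)
    (P : probability T R) (I : finType) (alpha : I -> T -> R[i]) (j0 : I) :
  iid_standard_complex_gaussian P alpha ->
  (cylinders_off alpha j0 `<=` measurable)%classic.
Proof.
move=> [gauss _] _ [B mB ->]; apply: fin_bigcap_measurable => //.
by move=> i _; exact: gaussian_event_measurable.
Qed.

(** Mutual independence is used twice, for the family of all indices and for
    the family of the indices other than [j0]. *)
Lemma cylinders_off_independent (R : realType) d (T : measurableType d)
    (P : probability T R) (I : finType) (alpha : I -> T -> R[i]) (j0 : I) A B :
  iid_standard_complex_gaussian P alpha ->
  cylinders_off alpha j0 A -> measurable B ->
  (P (A `&` (@complex_pair R \o alpha j0) @^-1` B)%classic =
   P A * P ((@complex_pair R \o alpha j0) @^-1` B)%classic)%E.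
Proof.
move=> [_ ind] [C mC ->] mB.
pose C' i := if i == j0 then B else C i.
have mC' i : measurable (C' i) by rewrite /C'; case: ifP.
rewrite ind//; transitivity (P (\bigcap_(i in [set` [set: I]%SET])
    ((@complex_pair R \o alpha i) @^-1` C' i))%classic).
  congr (P _); apply/seteqP; split => [w [/= h1 h2] i _|w /= h].
    rewrite /C' /=; case: ifPn => [/eqP -> //|ij]; apply: h1.
    by rewrite /= !inE.
  split => [i /=|]; last by have := h j0; rewrite /C' eqxx; apply; rewrite /= inE.
  by rewrite !inE => ij; have := h i; rewrite /C' (negbTE ij); apply; rewrite /= inE.
rewrite ind// (bigD1 j0) ?inE//= {1}/C' eqxx muleC; congr (_ * _)%E.
apply: eq_big => [i|i]; rewrite !inE// => ij.
by rewrite /C' (negbTE ij).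
Qed.

Lemma cmeasurable_off (R : realType) d (T : measurableType d) (I : finType)
    (alpha : I -> T -> R[i]) (i j0 : I) : i != j0 ->
  @cmeasurable R _ (g_sigma_algebraType (cylinders_off alpha j0)) (alpha i).
Proof.
move=> ij _ B mB; rewrite setTI; apply: sub_sigma_algebra.
exists (fun k => if k == i then B else setT) => [k|]; first by case: ifP.
apply/seteqP; split => [w h k _ /=|w h]; first by case: ifP => [/eqP->|].
by have := h i; rewrite /= eqxx !inE => /(_ ij).
Qed.

(** Given the other variables, [c alpha_j0] has to fall in a disc of radius
    [t] whose centre [- Y] is already determined. *)
Lemma small_ball_step (R : realType) d (T : measurableType d)
    (P : probability T R) (I : finType) (alpha : I -> T -> R[i]) (j0 : I)
    (A : set T) (Y : T -> R[i]) (c : R[i]) (D t : R) :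
  iid_standard_complex_gaussian P alpha ->
  <<s cylinders_off alpha j0 >>%classic A ->
  @cmeasurable R _ (g_sigma_algebraType (cylinders_off alpha j0)) Y ->
  0 < D -> D <= normc c -> 0 <= t ->
  (P (A `&` [set w | (normc (c * alpha j0 w + Y w) <= t)%R])%classic <=
   (4 * (t / D) ^+ 2)%:E * P A)%E.
Proof.
move=> iid GA mY D0 Dc t0.
pose Gt := g_sigma_algebraType (cylinders_off alpha j0).
pose W : set (Gt * (measurableTypeR R * measurableTypeR R)) :=
  [set p | normc (c * pair_complex p.2 + Y p.1) <= t]%classic.
have c0 : c != 0 by rewrite -normc_gt0 (lt_le_trans D0).
have mW : measurable W.
  apply: cmeasurable_normc_le; apply: cmeasurableD.
    apply: cmeasurableM; first exact: cmeasurable_cst.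
    apply/cmeasurableP; split; apply: (measurableT_comp _ measurable_snd).
      exact: measurable_fst.
    exact: measurable_snd.
  by apply: (measurableT_comp mY); exact: measurable_fst.
have := @independent_section_bound _ _ _ _ R P (cylinders_off alpha j0)
  (@complex_pair R \o alpha j0) (4 * (t / D) ^+ 2)%:E A W.
set Z := [set w | _]%classic; set Z' := [set w | _]%classic.
have -> : Z = Z'.
  by apply/seteqP; split => w; rewrite /Z/Z'/W/=; case: (alpha j0 w).
apply => //.
- exact: cylinders_off_measurable iid.
- exact: cylinders_off_setI.
- by have [+ _] := iid => /(_ j0)[].
- by move=> *; exact: cylinders_off_independent.
- by rewrite lee_fin mulr_ge0// sqr_ge0.
move=> w _; apply: (gaussian_disc_le (c := - (Y w / c))).
- by have [+ _] := iid; apply.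
- by rewrite divr_ge0// ltW.
- exact: measurable_xsection.
move=> u; rewrite /xsection/= inE /W/= => h.
rewrite opprK ler_pdivlMr//; apply: le_trans h.
rewrite -[X in normc (X * _ + _)]mulr1.
have -> : c * 1 * pair_complex u + Y w = c * (pair_complex u + Y w / c).
  by field.
by rewrite normcM mulrC ler_wpM2r ?normc_ge0.
Qed.

(** The form of index [k] contains the variable [alpha (J k)] with a
    coefficient at least [D], and no other form of equal or higher rank
    contains it.  Removing a form of minimal rank therefore leaves an event
    that does not depend on its variable, and conditioning on everything else
    costs the factor [4 (t / D)^2]. *)
Lemma small_ball_triangular (R : realType) d (T : measurableType d)
    (P : probability T R) (I K : finType) (alpha : I -> T -> R[i])
    (J : K -> I) (nu : K -> nat) (c : K -> I -> R[i]) (D t : R) :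
  iid_standard_complex_gaussian P alpha -> 0 < D -> 0 <= t ->
  (forall k, D <= normc (c k (J k))) ->
  (forall k k', k' != k -> (nu k <= nu k')%N -> c k' (J k) = 0) ->
  forall S : {set K},
  (P (\bigcap_(k in [set` S])
       [set w | (normc (\sum_i c k i * alpha i w) <= t)%R])%classic <=
   ((4 * (t / D) ^+ 2) ^+ #|S|)%:E)%E.
Proof.
move=> iid D0 t0 Dc tri S.
have [n Sn] := ubnP #|S|; elim: n => // n IH in S Sn *.
have [->|[k1 k1S]] := set_0Vmem S.
  rewrite cards0 expr0 (_ : bigcap _ _ = setT) ?probability_setT//.
  by apply/seteqP; split => // w _ k; rewrite /= inE.
(* A form of minimal rank: its variable is absent from the remaining ones. *)
case: (arg_minnP (P := fun k => k \in S) nu k1S) => k0 k0S kmin.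
pose S' := S :\ k0.
have Sc : #|S| = #|S'|.+1 by rewrite (cardsD1 k0) k0S.
pose E k := [set w | (normc (\sum_i c k i * alpha i w) <= t)%R]%classic.
have -> : (\bigcap_(k in [set` S]) E k = (\bigcap_(k in [set` S']) E k) `&`
   [set w | (normc (c k0 (J k0) * alpha (J k0) w +
      \sum_(i | i != J k0) c k0 i * alpha i w) <= t)%R])%classic.
  apply/seteqP; split => w /=.
    move=> h; split; last by have := h _ k0S; rewrite /E/= (bigD1 (J k0)).
    by move=> k /=; rewrite !inE => /andP[_ kS]; exact: h.
  move=> [h1 h2] k /= kS; have [->|kk0] := eqVneq k k0.
    by rewrite /E/= (bigD1 (J k0)).
  by apply: h1; rewrite /= !inE kk0.
have mS (k : K) (Q : pred I) : (forall i, Q i -> i != J k0 \/ c k i = 0) ->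
    @cmeasurable R _ (g_sigma_algebraType (cylinders_off alpha (J k0)))
      (fun w => \sum_(i | Q i) c k i * alpha i w).
  move=> hQ; under eq_fun do rewrite big_mkcond.
  apply: cmeasurable_sum => i; case: (boolP (Q i)) => [/hQ[iJ|ck0]|_].
  - by apply: cmeasurableM; [exact: cmeasurable_cst | exact: cmeasurable_off].
  - by under eq_fun do rewrite ck0 mul0r; exact: cmeasurable_cst.
  - exact: cmeasurable_cst.
apply: le_trans (small_ball_step iid _ _ D0 (Dc k0) t0) _.
- apply: (@fin_bigcap_measurable _
    (g_sigma_algebraType (cylinders_off alpha (J k0)))) => // k.
  rewrite /= !inE => /andP[kk0 kS]; apply: cmeasurable_normc_le.
  apply: mS => i _; have [->|] := eqVneq i (J k0); last by left.
  by right; apply: tri => //; exact: kmin.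
- by apply: mS => i iJ; left.
rewrite Sc; set kappa := 4 * _; rewrite exprS (EFinM kappa).
apply: lee_wpmul2l; first by rewrite lee_fin mulr_ge0 ?sqr_ge0.
by apply: IH; rewrite -ltnS -Sc.
Qed.

(** * Measurability of the hole *)

Definition ccontinuous (R : realType) (V : topologicalType) (f : V -> R[i]) :=
  continuous (fun x => complex.Re (f x) : R) /\
  continuous (fun x => complex.Im (f x) : R).

Lemma ccontinuous_cst (R : realType) (V : topologicalType) (c : R[i]) :
  ccontinuous (fun _ : V => c).
Proof. by split => x; exact: cvg_cst. Qed.

Lemma ccontinuousD (R : realType) (V : topologicalType) (f g : V -> R[i]) :
  ccontinuous f -> ccontinuous g -> ccontinuous (fun x => f x + g x).
Proof.
move=> [fr fi] [gr gi]; split.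
- rewrite (_ : (fun _ => _) = fun w => complex.Re (f w) + complex.Re (g w)).
    by move=> x; apply: cvgD; [exact: fr | exact: gr].
  by apply/funext => w; case: (f w) (g w) => [? ?] [? ?].
- rewrite (_ : (fun _ => _) = fun w => complex.Im (f w) + complex.Im (g w)).
    by move=> x; apply: cvgD; [exact: fi | exact: gi].
  by apply/funext => w; case: (f w) (g w) => [? ?] [? ?].
Qed.

Lemma ccontinuousM (R : realType) (V : topologicalType) (f g : V -> R[i]) :
  ccontinuous f -> ccontinuous g -> ccontinuous (fun x => f x * g x).
Proof.
move=> [fr fi] [gr gi]; split.
- rewrite (_ : (fun _ => _) = fun w => complex.Re (f w) * complex.Re (g w) -
      complex.Im (f w) * complex.Im (g w)).
    by move=> x; apply: cvgB; apply: cvgM; [exact: fr|exact: gr|exact: fi|exact: gi].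
  by apply/funext => w; case: (f w) (g w) => [? ?] [? ?].
- rewrite (_ : (fun _ => _) = fun w => complex.Re (f w) * complex.Im (g w) +
      complex.Im (f w) * complex.Re (g w)).
    by move=> x; apply: cvgD; apply: cvgM; [exact: fr|exact: gi|exact: fi|exact: gr].
  by apply/funext => w; case: (f w) (g w) => [? ?] [? ?].
Qed.

Lemma ccontinuous_sum (R : realType) (V : topologicalType) (I : Type)
    (s : seq I) (f : I -> V -> R[i]) :
  (forall i, ccontinuous (f i)) -> ccontinuous (fun w => \sum_(i <- s) f i w).
Proof.
move=> mf; elim: s => [|i s IH].
  by under eq_fun do rewrite big_nil; exact: ccontinuous_cst.
by under eq_fun do rewrite big_cons; exact: ccontinuousD.
Qed.

Lemma ccontinuous_prod (R : realType) (V : topologicalType) (I : Type)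
    (s : seq I) (f : I -> V -> R[i]) :
  (forall i, ccontinuous (f i)) -> ccontinuous (fun w => \prod_(i <- s) f i w).
Proof.
move=> mf; elim: s => [|i s IH].
  by under eq_fun do rewrite big_nil; exact: ccontinuous_cst.
by under eq_fun do rewrite big_cons; exact: ccontinuousM.
Qed.

Lemma ccontinuousX (R : realType) (V : topologicalType) (f : V -> R[i]) n :
  ccontinuous f -> ccontinuous (fun x => f x ^+ n).
Proof.
move=> cf; elim: n => [|n IH].
  by under eq_fun do rewrite expr0; exact: ccontinuous_cst.
by under eq_fun do rewrite exprS; exact: ccontinuousM.
Qed.

Lemma continuous_sqnorm (R : realType) (V : topologicalType) (f : V -> R[i]) :
  ccontinuous f -> continuous (fun x => sqnorm (f x)).
Proof.
move=> [fr fi] x; apply: cvgD; apply: cvgM; by [exact: fr | exact: fi].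
Qed.

Lemma continuous_sum_seq (R : realType) (V : topologicalType) (I : Type)
    (s : seq I) (f : I -> V -> R) :
  (forall i, continuous (f i)) -> continuous (fun w => \sum_(i <- s) f i w).
Proof.
move=> mf; elim: s => [|i s IH].
  by under eq_fun do rewrite big_nil; move=> x; exact: cvg_cst.
under eq_fun do rewrite big_cons.
by move=> x; apply: cvgD; [exact: mf | exact: IH].
Qed.

(** Points of [C^m] as rows of [2 m] real numbers, the space on which the
    extreme value theorem and the density of rational points are applied. *)
Definition complexify (R : realType) m (x : 'rV[R]_(m + m)) : 'rV[R[i]]_m :=
  \row_k (x 0 (lshift m k) +i* x 0 (rshift m k)).

Lemma complexify_surj (R : realType) m (z : 'rV[R[i]]_m) :
  {x : 'rV[R]_(m + m) | complexify x = z}.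
Proof.
exists (row_mx (\row_k complex.Re (z 0 k)) (\row_k complex.Im (z 0 k))).
apply/rowP => k; rewrite !mxE; case: splitP => [j /= /val_inj <-|j /= /eqP];
  last by rewrite ltn_eqF// (leq_trans (ltn_ord k))// leq_addr.
rewrite mxE; case: splitP => [i /= /eqP|i /= /eqP].
  by rewrite gtn_eqF// (leq_trans (ltn_ord i))// leq_addr.
by rewrite eqn_add2l => /eqP/val_inj <-; rewrite mxE; case: (z 0 k).
Qed.

Lemma ccontinuous_complexify (R : realType) m (k : 'I_m) :
  ccontinuous (fun x : 'rV[R]_(m + m) => complexify x 0 k).
Proof.
split; under eq_fun do rewrite /complexify mxE /=; exact: coord_continuous.
Qed.

Lemma ccontinuous_su_polynomial (R : realType) m N (a : multiindex m N -> R[i]) :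
  ccontinuous (fun x : 'rV[R]_(m + m) => su_polynomial a (complexify x)).
Proof.
apply: ccontinuous_sum => j; apply: ccontinuousM; first exact: ccontinuous_cst.
apply: ccontinuous_prod => k; apply: ccontinuousX.
exact: ccontinuous_complexify.
Qed.

Lemma eucl_ballE (R : realType) m (r : R) (z : 'rV[R[i]]_m) : 0 < r ->
  eucl_ball r z <-> \sum_(k < m) sqnorm (z 0 k) < r ^+ 2.
Proof.
move=> r0; rewrite /eucl_ball /eucl_norm /=.
have -> : \sum_(k < m) normc (z 0 k) ^+ 2 = \sum_(k < m) sqnorm (z 0 k).
  apply: eq_bigr => k _; case: (z 0 k) => a b /=.
  by rewrite sqr_sqrtr// addr_ge0// sqr_ge0.
have S0 : 0 <= \sum_(k < m) sqnorm (z 0 k) by apply: sumr_ge0 => k _; exact: sqnorm_ge0.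
by rewrite -{1}(ger0_norm (ltW r0)) -sqrtr_sqr ltr_sqrt// exprn_gt0.
Qed.

Lemma rational_row_dense (R : realType) p (U : set 'rV[R]_p) (x : 'rV[R]_p) :
  nbhs x U -> exists q : 'rV[rat]_p, U (map_mx ratr q).
Proof.
move=> /nbhs_ballP[e /= e0 xU].
have H (k : 'I_p) : exists q : rat, `|x 0 k - ratr q| < e.
  have [|q] := @rat_in_itvoo R (x 0 k - e) (x 0 k + e); first by lra.
  by rewrite in_itv/= -ltr_distlC distrC => h; exists q; rewrite distrC.
have [f Hf] := choice H.
exists (\row_k f k); apply: xU; split=> // i j; rewrite !mxE ord1; exact: Hf.
Qed.

Lemma compact_sublevel (R : realType) m (s : R) :
  compact [set x : 'rV[R]_(m + m) |
    \sum_(k < m) sqnorm (complexify x 0 k) <= s]%classic.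
Proof.
have cont : continuous (fun x : 'rV[R]_(m + m) =>
    \sum_(k < m) sqnorm (complexify x 0 k)).
  apply: continuous_sum_seq => k; apply: continuous_sqnorm.
  exact: ccontinuous_complexify.
apply: (@subclosed_compact _ _ [set x : 'rV[R]_(m + m) |
   forall i : 'I_(m + m), `[- (1 + `|s|), 1 + `|s|]%classic (x ord0 i)]%classic).
- apply: (@closed_comp _ _ (fun x => \sum_(k < m) sqnorm (complexify x 0 k))
     [set y : R | y <= s]%classic); last exact: closed_le.
  by move=> x _; exact: cont.
- apply: (@rV_compact _ (m + m) (fun=> `[- (1 + `|s|), 1 + `|s|]%classic)) => i.
  exact: segment_compact.
move=> x /= hx i.
have hi : (x 0 i) ^+ 2 <= s.
  apply: le_trans hx; case: (splitP i) => [k ik|k ik].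
    rewrite (bigD1 k)//= mxE /sqnorm /=.
    have -> : lshift m k = i by apply: val_inj; rewrite /= ik.
    rewrite -addrA lerDl addr_ge0 ?sqr_ge0// sumr_ge0// => l _.
    exact: sqnorm_ge0.
  rewrite (bigD1 k)//= mxE /sqnorm /=.
  have -> : rshift m k = i by apply: val_inj; rewrite /= ik.
  rewrite addrAC lerDr addr_ge0 ?sqr_ge0// sumr_ge0// => l _.
  exact: sqnorm_ge0.
rewrite /= in_itv/= -ler_norml.
have : `|x 0 i| ^+ 2 <= `|s| by rewrite real_normK ?num_real// (le_trans hi)// ler_norm.
have := normr_ge0 s; have := normr_ge0 (x 0 i); nra.
Qed.

(** A zero in the open ball lies in a smaller closed ball, where it is a limit
    of rational points with small values.  Conversely, small values at points
    of the smaller ball force the minimum of [|f|] over this compact set to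
    be 0. *)
Lemma zero_in_ball_iff_rational (R : realType) m N
    (a : multiindex m N -> R[i]) (r : R) : 0 < r ->
  (exists2 z, eucl_ball r z & su_polynomial a z = 0) <->
  (exists k : nat, forall n : nat, exists q : 'rV[rat]_(m + m),
     \sum_(l < m) sqnorm (complexify (map_mx ratr q : 'rV[R]_(m + m)) 0 l)
       <= r ^+ 2 - k.+1%:R^-1 /\
     sqnorm (su_polynomial a (complexify (map_mx ratr q))) <= n.+1%:R^-1).
Proof.
move=> r0; split.
- move=> [z /(eucl_ballE _ r0) zr z0].
  have [x xz] := complexify_surj z.
  set S := \sum_(k < m) _ in zr.
  have [k hk] : exists k : nat, S < r ^+ 2 - k.+1%:R^-1.
    have e0 : 0 < r ^+ 2 - S by rewrite subr_gt0.
    have [k hk] := ltr_add_invr e0.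
    by exists k; move: hk; rewrite add0r ltrBrDr addrC -ltrBrDr.
  exists k => n.
  pose g1 (x : 'rV[R]_(m + m)) := \sum_(l < m) sqnorm (complexify x 0 l).
  pose g2 (x : 'rV[R]_(m + m)) := sqnorm (su_polynomial a (complexify x)).
  have c1 : continuous g1.
    apply: continuous_sum_seq => l; apply: continuous_sqnorm.
    exact: ccontinuous_complexify.
  have c2 : continuous g2.
    by apply: continuous_sqnorm; exact: ccontinuous_su_polynomial.
  have n1 : nbhs (g1 x) [set y | y < r ^+ 2 - k.+1%:R^-1]%classic.
    by apply: open_nbhs_nbhs; split; [exact: open_lt | rewrite /= /g1 xz].
  have n2 : nbhs (g2 x) [set y | y < n.+1%:R^-1]%classic.
    apply: open_nbhs_nbhs; split; first exact: open_lt.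
    by rewrite /= /g2 xz z0 /sqnorm/= expr0n/= addr0 invr_gt0.
  have n12 : nbhs x (g1 @^-1` [set y | y < r ^+ 2 - k.+1%:R^-1] `&`
      g2 @^-1` [set y | y < n.+1%:R^-1])%classic.
    by apply: filterI; [exact: (c1 x _ n1) | exact: (c2 x _ n2)].
  have [q [h1 h2]] := rational_row_dense n12.
  by exists q; split; exact: ltW.
- move=> [k hk].
  pose K := [set x : 'rV[R]_(m + m) |
    \sum_(l < m) sqnorm (complexify x 0 l) <= r ^+ 2 - k.+1%:R^-1]%classic.
  have [q0 [q0K _]] := hk 0%N.
  have [||c cK hc] := @compact_EVT_min _ R
      (fun x => sqnorm (su_polynomial a (complexify x))) K _ (@compact_sublevel R m _).
  + by exists (map_mx ratr q0).
  + apply: continuous_subspaceT; apply: continuous_sqnorm.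
    exact: ccontinuous_su_polynomial.
  exists (complexify c).
    apply/eucl_ballE => //; move/set_mem: cK => /= /le_lt_trans; apply.
    by rewrite ltrBlDr ltrDl invr_gt0.
  apply/eqP; rewrite -sqnorm_eq0 eq_le sqnorm_ge0 andbT leNgt; apply/negP => h.
  have [n hn] := ltr_add_invr h.
  have [q [qK qn]] := hk n.
  have := hc (map_mx ratr q); rewrite inE => /(_ qK) h2.
  by move: hn; rewrite add0r => /lt_le_trans/(_ h2)/lt_le_trans/(_ qn); rewrite ltxx.
Qed.

(** The hole is an uncountable intersection over the ball, which the rational
    characterization turns into countable operations on measurable events. *)
Lemma measurable_hole (R : realType) m N d
    (T : measurableType d) (alpha : multiindex m N -> T -> R[i]) (r : R) :
  0 < r -> (forall j, cmeasurable (alpha j)) -> measurable (hole alpha r).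
Proof.
move=> r0 ma.
pose A (k : nat) (q : 'rV[rat]_(m + m)) :=
  \sum_(l < m) sqnorm (complexify (map_mx ratr q : 'rV[R]_(m + m)) 0 l)
    <= r ^+ 2 - k.+1%:R^-1.
pose E (k n : nat) (q : 'rV[rat]_(m + m)) : set T := [set w | A k q /\
  sqnorm (su_polynomial (alpha^~ w) (complexify (map_mx ratr q))) <= n.+1%:R^-1]%classic.
rewrite (_ : hole alpha r = ~` (\bigcup_k \bigcap_n \bigcup_q E k n q))%classic.
  apply: measurableC; apply: bigcupT_measurable => k.
  apply: bigcapT_measurable => n.
  apply: countable_bigcupT_measurable; first exact: countableP.
  move=> q; rewrite /E; have [hA|hA] := boolP (A k q); last first.
    by rewrite (_ : [set _ | _]%classic = set0)//; apply/seteqP; split => w // [].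
  set z := complexify _.
  rewrite (_ : [set _ | _]%classic = ((fun w => sqnorm (su_polynomial (alpha^~ w) z))
    @^-1` `]-oo, n.+1%:R^-1])%classic).
    rewrite -[X in measurable X]setTI; apply: measurable_sqnorm => //.
    apply: cmeasurable_sum => j; apply: cmeasurableM; last exact: cmeasurable_cst.
    by apply: cmeasurableM; [exact: ma | exact: cmeasurable_cst].
  by apply/seteqP; split => w /=; rewrite in_itv/=; [case|].
apply/seteqP; split => w.
- move=> hw [k _ h]; have [|z zr z0] := (zero_in_ball_iff_rational (alpha^~ w) r0).2.
    by exists k => n; have [q _ hq] := h n I; exists q.
  by have := hw z zr; rewrite z0 eqxx.
- move=> h z zr; apply/eqP => z0; apply: h.
  have [|k hk] := (zero_in_ball_iff_rational (alpha^~ w) r0).1; first by exists z.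
  by exists k => // n _; have [q hq] := hk n; exists q.
Qed.

(** * Multinomial coefficients and multi-indices *)

Lemma bin_le_exp2 n k : ('C(n, k) <= 2 ^ n)%N.
Proof.
have [kn|/bin_small->//] := leqP k n.
rewrite -[2%N]/(1 + 1)%N Pascal.
rewrite (bigD1 (inord k))//= inordK ?ltnS// !exp1n !muln1 leq_addr//.
Qed.

(** [N^k] is at most the falling factorial [(N + k)^_k = 'C(N + k, k) k!]. *)
Lemma expn_le_fact N k : (N ^ k <= 2 ^ (N + k) * k`!)%N.
Proof.
apply: (@leq_trans ((N + k) ^_ k)).
  rewrite ffact_prod -[in leqLHS](card_ord k) -prod_nat_const.
  by apply: leq_prod => i _; have := ltn_ord i; lia.
by rewrite -bin_ffact leq_mul2r bin_le_exp2 orbT.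
Qed.

Lemma fact_le_exp n M : (n <= M)%N -> (n`! <= M ^ n)%N.
Proof.
move=> nM; rewrite -ffactnn ffact_prod -[in leqRHS](card_ord n) -prod_nat_const.
by apply: leq_prod => i _; lia.
Qed.

Lemma mdeg_le m N (j : multiindex m N) : (mdeg j <= N)%N.
Proof. exact: (valP j). Qed.

Lemma mexp_le m N (j : multiindex m N) k : (mexp j k <= N)%N.
Proof. by rewrite -ltnS ltn_ord. Qed.

Lemma mbinomE (R : realType) m N (j : multiindex m N) :
  mbinom R j = (N ^_ (mdeg j))%:R / (\prod_(k < m) (mexp j k)`!)%:R.
Proof.
rewrite /mbinom -(ffact_fact (mdeg_le j)) !natrM invfM mulrA.
by congr (_ / _); rewrite mulfK// pnatr_eq0 -lt0n fact_gt0.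
Qed.

Lemma prod_fact_gt0 m N (j : multiindex m N) :
  (0 < \prod_(k < m) (mexp j k)`!)%N.
Proof. by apply: prodn_gt0 => k; exact: fact_gt0. Qed.

Lemma mbinom_ge0 (R : realType) m N (j : multiindex m N) : 0 <= mbinom R j.
Proof. by rewrite divr_ge0. Qed.

(** Up to the bound [N^|j|] for the falling factorial, the coefficient is the
    product of the [N^j_k / j_k!], each at most [4^N]. *)
Lemma mbinom_le (R : realType) m N (j : multiindex m N) :
  mbinom R j <= (4 ^ (m * N))%:R.
Proof.
rewrite mbinomE ler_pdivrMr ?ltr0n ?prod_fact_gt0// -natrM ler_nat.
apply: (@leq_trans (N ^ mdeg j)).
  rewrite ffact_prod -[in leqRHS](card_ord (mdeg j)) -prod_nat_const.
  by apply: leq_prod => i _; exact: leq_subr.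
rewrite /mdeg expn_sum.
have -> : (4 ^ (m * N) = \prod_(k < m) 2 ^ (N + N))%N.
  by rewrite prod_nat_const card_ord addnn -mul2n (expnM 2) -expnM mulnC.
rewrite -big_split/=; apply: leq_prod => k _.
apply: leq_trans (expn_le_fact _ _) _.
by rewrite leq_mul2r leq_exp2l// leq_add2l mexp_le orbT.
Qed.

(** All the factors of the falling factorial are at least [2 p^2 L], whereas
    [j_k! <= (2 L)^j_k]. *)
Lemma mbinom_ge (R : realType) m N (j : multiindex m N) p L :
  (forall k, (mexp j k <= 2 * L)%N) -> (2 * p ^ 2 * L + mdeg j <= N)%N ->
  (p ^ (2 * mdeg j))%:R <= mbinom R j.
Proof.
move=> jL dN; rewrite mbinomE ler_pdivlMr ?ltr0n ?prod_fact_gt0// -natrM ler_nat.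
apply: (@leq_trans ((2 * p ^ 2 * L) ^ mdeg j)); last first.
  rewrite ffact_prod -[in leqLHS](card_ord (mdeg j)) -prod_nat_const.
  apply: leq_prod => i _; rewrite leq_subRL; last first.
    by rewrite (leq_trans (ltnW (ltn_ord i)))// (leq_trans _ dN)// leq_addl.
  by rewrite addnC (leq_trans _ dN)// leq_add2l ltnW.
rewrite mulnAC expnMn mulnC expnM leq_mul2r; apply/orP; right.
rewrite /mdeg expn_sum; apply: leq_prod => k _.
exact: fact_le_exp.
Qed.

Lemma card_multiindex m N : (#|{: multiindex m N}| <= N.+1 ^ m)%N.
Proof.
have := leq_card (val : multiindex m N -> {ffun 'I_m -> 'I_N.+1}) val_inj.
by rewrite card_ffun !card_ord.
Qed.

Lemma multiindex_of m N (e : 'I_m -> nat) : (\sum_(k < m) e k <= N)%N ->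
  {j : multiindex m N | forall k, mexp j k = e k}.
Proof.
move=> eN; have eN' k : (e k < N.+1)%N.
  by rewrite ltnS (leq_trans _ eN)// (bigD1 k)//= leq_addr.
have h : (\sum_(k < m) [ffun k => inord (e k) : 'I_N.+1] k <= N)%N.
  by under eq_bigr do rewrite ffunE inordK//.
exists (exist (fun j : {ffun 'I_m -> 'I_N.+1} => \sum_(k < m) j k <= N)%N _ h) => k.
by rewrite /mexp /= ffunE inordK.
Qed.

Lemma zero_index m N : {j : multiindex m N | forall k, mexp j k = 0%N}.
Proof. by apply: multiindex_of; rewrite big1. Qed.

Lemma mexp_inj m N (j j' : multiindex m N) : mexp j =1 mexp j' -> j = j'.
Proof.
by move=> h; apply: val_inj; apply/ffunP => k; apply: val_inj; exact: h.
Qed.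

Lemma mdeg0 m N (j : multiindex m N) :
  (forall k, mexp j k = 0%N) -> mdeg j = 0%N.
Proof. by move=> h; rewrite /mdeg big1. Qed.

Lemma su_polynomial_split (R : realType) m N (a : multiindex m N -> R[i])
    (j0 : multiindex m N) (z : 'rV[R[i]]_m) : (forall k, mexp j0 k = 0%N) ->
  su_polynomial a z = a j0 + \sum_(j | j != j0)
    a j * (Num.sqrt (mbinom R j))%:C * monomial_at j z.
Proof.
move=> j00; rewrite /su_polynomial (bigD1 j0)//=; congr (_ + _).
rewrite mbinomE mdeg0// /monomial_at ffactn0 !big1 => [|k _|k _].
- by rewrite divr1 sqrtr1 !mulr1.
- by rewrite j00.
- by rewrite j00.
Qed.

Lemma sqrt_mbinom_le (R : realType) m N (j : multiindex m N) :
  Num.sqrt (mbinom R j) <= (2 ^+ m) ^+ N.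
Proof.
have -> : (2 ^+ m) ^+ N = Num.sqrt ((2 ^+ m) ^+ N * (2 ^+ m) ^+ N) :> R.
  by rewrite -expr2 sqrtr_sqr ger0_norm// exprn_ge0// exprn_ge0.
rewrite ler_sqrt ?mulr_ge0 ?exprn_ge0//.
by apply: le_trans (mbinom_le _ _) _; rewrite natrX -!exprMn -exprM -natrM.
Qed.

Lemma eucl_ball_normc (R : realType) m (r : R) (z : 'rV[R[i]]_m) (k : 'I_m) :
  0 < r -> eucl_ball r z -> normc (z 0 k) < r.
Proof.
move=> r0 /(eucl_ballE _ r0) h.
have hk : sqnorm (z 0 k) < r ^+ 2.
  apply: le_lt_trans h; rewrite (bigD1 k)//= lerDl sumr_ge0// => l _.
  exact: sqnorm_ge0.
move: hk; case: (z 0 k) => a b /= hk.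
by rewrite -[ltRHS](ger0_norm (ltW r0)) -sqrtr_sqr ltr_sqrt// exprn_gt0.
Qed.

Lemma monomial_at_le (R : realType) m N (j : multiindex m N)
    (z : 'rV[R[i]]_m) (b : R) : 1 <= b -> (forall k, normc (z 0 k) <= b) ->
  normc (monomial_at j z) <= b ^+ N.
Proof.
move=> b1 zb; rewrite normc_prod.
apply: (@le_trans _ _ (\prod_(k < m) b ^+ mexp j k)).
  apply: ler_prod => k _; rewrite normc_ge0 normcX/=.
  by apply: lerXn2r => //; rewrite nnegrE ?normc_ge0// (le_trans _ b1).
by rewrite prodrXr ler_weXn2l// mdeg_le.
Qed.

(** * The lower bound *)

(** Each of the at most [2^(m N)] nonconstant terms is at most
    [2 eta 2^(m N) (1 + r)^N] on the ball; their sum is at most [1 / 2]. *)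
Lemma hole_of_dominant_constant (R : realType) m N (j0 : multiindex m N)
    (a : multiindex m N -> R[i]) (r eta : R) (z : 'rV[R[i]]_m) :
  0 < r -> (forall k, mexp j0 k = 0%N) -> 1 <= normc (a j0) ->
  0 <= eta -> (forall j, j != j0 -> normc (a j) <= 2 * eta) ->
  4 * eta * (4 ^+ m * (1 + r)) ^+ N <= 1 ->
  eucl_ball r z -> su_polynomial a z != 0.
Proof.
move=> r0 j00 a0 eta0 aj heta zr.
rewrite (su_polynomial_split a z j00); set S := \sum_(j | _) _.
have hS : normc S <= 1 / 2.
  apply: le_trans (ler_normc_sum _ _ _) _.
  apply: (@le_trans _ _ (\sum_(j : multiindex m N)
      (2 * eta * (2 ^+ m) ^+ N * (1 + r) ^+ N))).
    rewrite big_mkcond; apply: ler_sum => j _; case: ifP => [jj0|_]; last first.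
      by rewrite !mulr_ge0 ?exprn_ge0// ?exprn_ge0// addr_ge0 ?ltW.
    rewrite !normcM normc_real ger0_norm ?sqrtr_ge0//.
    apply: ler_pM; rewrite ?mulr_ge0 ?normc_ge0 ?sqrtr_ge0//.
      by apply: ler_pM; rewrite ?normc_ge0 ?sqrtr_ge0 ?aj ?sqrt_mbinom_le.
    apply: monomial_at_le => [|k]; first by rewrite lerDl ltW.
    by rewrite (le_trans (ltW (eucl_ball_normc k r0 zr)))// lerDr.
  rewrite sumr_const -[leLHS]mulr_natl.
  have hc : (#|{: multiindex m N}|)%:R <= ((2 ^+ m) ^+ N : R).
    apply: (@le_trans _ _ ((N.+1 ^ m)%:R)); first by rewrite ler_nat card_multiindex.
    rewrite natrX -exprM mulnC exprM; apply: lerXn2r; rewrite ?nnegrE ?exprn_ge0//.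
    by rewrite -natrX ler_nat ltn_expl.
  set M := 2 * eta * _ * _.
  have M0 : 0 <= M by rewrite !mulr_ge0 ?exprn_ge0// ?exprn_ge0// addr_ge0 ?ltW.
  apply: le_trans (ler_wpM2r M0 hc) _; rewrite /M.
  move: heta; have -> : 4 ^+ m = 2 ^+ m * 2 ^+ m :> R.
    by rewrite -exprMn -natrM.
  by rewrite !exprMn; lra.
apply/eqP => /eqP; rewrite addr_eq0 => /eqP aS.
by move: a0; rewrite aS normc_opp; lra.
Qed.

Lemma gaussian_cmeasurable (R : realType) d (T : measurableType d)
    (P : probability T R) (X : T -> R[i]) :
  standard_complex_gaussian P X -> cmeasurable X.
Proof. by case. Qed.

Lemma pi_inv_ge (R : realType) : expR (- 3) <= pi^-1 :> R.
Proof.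
rewrite expRN lef_pV2 ?posrE ?pi_gt0 ?expR_gt0//.
have [/andP[_ h] _] := pihalf_02_cos_pihalf R.
by have := expR_ge1Dx (3 : R); lra.
Qed.

Lemma gaussian_box_lower (R : realType) d (T : measurableType d)
    (P : probability T R) (X : T -> R[i]) (a1 a2 h : R) :
  standard_complex_gaussian P X -> 0 <= a1 -> 0 <= a2 -> 0 <= h ->
  a1 + h <= 2 -> a2 + h <= 1 ->
  ((expR (- 8) * h ^+ 2)%:E <=
   P ((@complex_pair R \o X) @^-1` (`[a1, (a1 + h)%R] `*` `[a2, (a2 + h)%R]))%classic)%E.
Proof.
move=> gX a10 a20 h0 h1 h2.
have := @gaussian_box_ge R d T P X a1 (a1 + h) a2 (a2 + h) (expR (- 8)) gX.
have -> : (a1 + h - a1) * (a2 + h - a2) = h ^+ 2 by rewrite expr2; lra.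
apply; [lra|lra|exact: expR_ge0|move=> x y /andP[x1 x2] /andP[y1 y2]].
rewrite -[_ +i* _]/(pair_complex (x, y)) complex_gaussian_pdfE/=.
have -> : - 8 = - 3 + - 5 :> R by lra.
rewrite expRD ler_pM ?expR_ge0 ?pi_inv_ge// ler_expR lerN2.
by rewrite !expr2; nra.
Qed.

Lemma lee_prod_ge0 (R : realDomainType) (I : Type) (s : seq I) (F G : I -> \bar R) :
  (forall i, 0 <= F i <= G i)%E ->
  (\prod_(i <- s) F i <= \prod_(i <- s) G i)%E.
Proof.
move=> FG; suff : (0 <= \prod_(i <- s) F i <= \prod_(i <- s) G i)%E.
  by case/andP.
apply: (big_ind2 (fun x y => 0 <= x <= y)%E); first by rewrite lexx lee01.
  move=> x1 x2 y1 y2 /andP[h1 h2] /andP[h3 h4].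
  by rewrite mule_ge0//= lee_pmul.
by move=> i _; exact: FG.
Qed.

Lemma leq_expn2 a b e : (a <= b)%N -> (a ^ e <= b ^ e)%N.
Proof. by case: e => // e ab; rewrite leq_exp2r. Qed.

(** By independence the probability of the event is a product of at most
    [(2 N)^m] factors, each at least [exp (- C N)]. *)
Lemma hole_probability_lower (R : realType) m (r : R) : 0 < r ->
  forall N : nat, (0 < N)%N ->
  forall (d : measure_display) (T : measurableType d) (P : probability T R)
    (alpha : multiindex m N -> T -> R[i]),
  iid_standard_complex_gaussian P alpha ->
  ((expR (- ((12 + 2 * (4 ^+ m * (1 + r))) * 2 ^+ m * N%:R ^+ m.+1)))%:E
     <= P (hole alpha r))%E.
Proof.
move=> r0 N N0 d T P alpha iid; have [gauss ind] := iid.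
set b := 4 ^+ m * (1 + r).
have b1 : 1 <= b.
  have h4 : 1 <= 4 ^+ m :> R by apply: exprn_ege1; lra.
  by rewrite /b; nra.
have b0 : 0 < b by exact: lt_le_trans b1.
have bN0 : 0 < b ^+ N by rewrite exprn_gt0.
pose eta := (4 * b ^+ N)^-1.
have eta0 : 0 < eta by rewrite invr_gt0 mulr_gt0.
have eta1 : eta <= 1.
  rewrite invf_le1 ?mulr_gt0//.
  by have := exprn_ege1 N b1; lra.
have [j0 j00] := zero_index m N.
pose Q j : set (measurableTypeR R * measurableTypeR R) :=
  if j == j0 then (`[1, 1 + 1] `*` `[0, 0 + 1])%classic
  else (`[0, 0 + eta] `*` `[0, 0 + eta])%classic.
have mQ j : measurable (Q j) by rewrite /Q; case: ifP => _; exact: measurableX.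
(* [exp (- 8)] bounds the density from below on both kinds of boxes. *)
pose theta := expR (- 8) * eta ^+ 2.
have theta0 : 0 <= theta by rewrite mulr_ge0 ?expR_ge0 ?sqr_ge0.
have Qtheta j : (theta%:E <= P ((@complex_pair R \o alpha j) @^-1` Q j)%classic)%E.
  rewrite /Q; case: ifP => _.
    have h1 : 1 + 1 <= 2 :> R by lra.
    have h2 : 0 + 1 <= 1 :> R by lra.
    apply: le_trans (gaussian_box_lower (gauss j) ler01 (lexx 0) ler01 h1 h2).
    by rewrite lee_fin /theta ler_wpM2l ?expR_ge0// expr1n exprn_ile1// ltW.
  by apply: gaussian_box_lower => //; lra.
pose E := (\bigcap_(j in [set` [set: multiindex m N]%SET])
             ((@complex_pair R \o alpha j) @^-1` Q j))%classic.
have mE : measurable E.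
  by apply: fin_bigcap_measurable => // j _; exact: gaussian_event_measurable.
have mH : measurable (hole alpha r).
  by apply: measurable_hole => // j; exact: gaussian_cmeasurable (gauss j).
have EH : (E `<=` hole alpha r)%classic.
  move=> w Ew z zr.
  have Ej j : Q j (complex_pair (alpha j w)) by apply: (Ew j); rewrite /= inE.
  apply: (@hole_of_dominant_constant R m N j0 (alpha^~ w) r eta z) => //.
  - have := Ej j0; rewrite /Q eqxx => -[/=]; rewrite in_itv/= => /andP[h _] _.
    by apply: le_trans h _; apply: le_trans (normc_Re _); exact: ler_norm.
  - exact: ltW.
  - move=> j jj0; have := Ej j; rewrite /Q (negbTE jj0) => -[/=].
    rewrite !in_itv/= => /andP[x0 x1] /andP[y0 y1].
    apply: le_trans (normc_le_ReIm _) _; rewrite !ger0_norm//.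
    by move: x1 y1; rewrite !add0r; lra.
  - rewrite -/b /eta invfM mulrA mulfV// mul1r mulVf//.
    by rewrite gt_eqF.
apply: le_trans (le_measure _ (mem_set mE) (mem_set mH) EH).
rewrite [leRHS](ind [set: multiindex m N]%SET Q mQ).
apply: (@le_trans _ _ (\prod_(j : multiindex m N) theta%:E)%E); last first.
  rewrite [leRHS](eq_bigl xpredT) => [|j]; last by rewrite inE.
  by apply: lee_prod_ge0 => j; rewrite lee_fin theta0 Qtheta.
rewrite prodEFin lee_fin prodr_const.
have theta_ge : expR (- ((12 + 2 * b) * N%:R)) <= theta.
  have N1 : 1 <= N%:R :> R by rewrite ler1n.
  rewrite /theta /eta invfM exprMn.
  apply: (@le_trans _ _ (expR (- 8) * (expR (- 4) * expR (- (2 * b * N%:R))))).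
    by rewrite -!expRD ler_expR; nra.
  rewrite ler_wpM2l ?expR_ge0// ler_pM ?expR_ge0//.
    rewrite expRN exprVn lef_pV2 ?posrE ?expR_gt0 ?exprn_gt0//.
    have -> : expR 4 = (expR 1) ^+ 4 :> R by rewrite -expRM_natr mul1r.
    have h2 : 2 <= expR 1 :> R by have := expR_ge1Dx (1 : R); lra.
    have -> : 4 ^+ 2 = 2 ^+ 4 :> R by lra.
    by apply: lerXn2r; rewrite ?nnegrE ?expR_ge0.
  have -> : 2 * b * N%:R = b * N%:R + b * N%:R by lra.
  rewrite expRN exprVn lef_pV2 ?posrE ?expR_gt0 ?exprn_gt0//.
  rewrite expRD -expr2 ler_pXn2r ?nnegrE ?expR_ge0 ?(ltW bN0)//.
  rewrite expRM_natr ler_pXn2r ?nnegrE ?expR_ge0//; last lra.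
  by have := expR_ge1Dx b; lra.
apply: (@le_trans _ _ (theta ^+ ((2 * N) ^ m))); last first.
  apply: ler_wiXn2l => //.
    have e8 : expR (- 8) <= 1 :> R by rewrite -[leRHS]expR0 ler_expR; lra.
    by apply: mulr_ile1; rewrite ?expR_ge0 ?sqr_ge0// exprn_ile1// ltW.
  apply: leq_trans (card_multiindex _ _) _; apply: leq_expn2; lia.
apply: (@le_trans _ _ (expR (- ((12 + 2 * b) * N%:R)) ^+ ((2 * N) ^ m))).
  rewrite -expRM_natl ler_expR mulrN lerN2.
  rewrite natrX natrM exprMn exprS le_eqVlt; apply/orP; left; apply/eqP; ring.
by apply: lerXn2r => //; rewrite nnegrE ?expR_ge0.
Qed.

(** * A hole forces small values on a polydisc *)

Lemma su_polynomial_on_line (R : realType) m N (a : multiindex m N -> R[i])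
    (u v : 'rV[R[i]]_m) :
  exists2 p : {poly R[i]}, (size p <= N.+1)%N &
    forall t, p.[t] = su_polynomial a (u + t *: v).
Proof.
exists (\sum_(j : multiindex m N) (a j * (Num.sqrt (mbinom R j))%:C)%:P *
   \prod_(k < m) ((v 0 k)%:P * 'X + (u 0 k)%:P) ^+ mexp j k).
  apply: leq_trans (size_sum _ _ _) _; apply/bigmax_leqP => j _.
  rewrite mul_polyC; apply: leq_trans (size_scale_leq _ _) _.
  apply: leq_trans (size_prod_leq _ _) _.
  rewrite leq_subLR cardE size_enum_ord -addSnnS.
  apply: (@leq_trans (\sum_(k < m) (mexp j k).+1).+1).
    rewrite ltnS; apply: leq_sum => k _; apply: leq_trans (size_poly_exp_leq _ _) _.
    rewrite ltnS -[leqRHS]mul1n leq_mul2r; apply/orP; right.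
    rewrite -ltnS (leq_trans (leqSpred _))// size_MXaddC.
    by case: ifP => // _; rewrite ltnS size_polyC_leq1.
  under eq_bigr do rewrite -addn1.
  by rewrite big_split/= sum1_card card_ord addSn ltnS addnC leq_add2l mdeg_le.
move=> t; rewrite horner_sum; apply: eq_bigr => j _.
rewrite hornerM hornerC horner_prod; congr (_ * _); apply: eq_bigr => k _.
by rewrite horner_exp !hornerE !mxE addrC mulrC.
Qed.

Lemma eucl_ball_of_coords (R : realType) m (r x : R) (z : 'rV[R[i]]_m) :
  (0 < m)%N -> 0 < r -> 0 <= x -> m%:R * x < r ->
  (forall k, normc (z 0 k) <= x) -> eucl_ball r z.
Proof.
move=> m0 r0 x0 mx zx; apply/eucl_ballE => //.
apply: (@le_lt_trans _ _ (\sum_(k < m) x ^+ 2)).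
  apply: ler_sum => k _; have := zx k; case: (z 0 k) => p q /= h.
  rewrite /sqnorm/= -(@ler_sqrt R) ?sqr_ge0// sqrtr_sqr ger0_norm//.
rewrite sumr_const card_ord -[ltLHS]mulr_natl.
have m1 : 1 <= m%:R :> R by rewrite ler1n.
apply: (@le_lt_trans _ _ ((m%:R * x) ^+ 2)).
  by rewrite exprMn ler_wpM2r ?sqr_ge0// expr2; nra.
by rewrite ltr_pXn2r// nnegrE ?mulr_ge0// ltW.
Qed.

(** If every vertex [w v], with [v = (s, .., s)], had a point at distance [d]
    in each coordinate where [|f|] exceeds [M], then [|f (w v)|] would exceed
    [M / (1 + eps)^N] by the growth bound along the line through both points,
    and the product over the polygon would exceed [2^N |f 0|^n]. *)
Lemma hole_forces_small_polydisc (R : realType) m N (a : multiindex m N -> R[i])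
    (j0 : multiindex m N) (r s d eps A M : R) (n : nat) (ws : seq R[i]) :
  (0 < m)%N -> 0 < r -> 0 < s -> 0 < d -> m%:R * s <= r / 4 ->
  2 * m%:R * d <= r * eps -> 0 < eps -> (0 < n)%N ->
  'X^n - 1 = \prod_(w <- ws) ('X - w%:P) ->
  (forall k, mexp j0 k = 0%N) -> normc (a j0) <= A -> 0 <= M ->
  2 ^+ N * (A * (1 + eps) ^+ N) ^+ n < M ^+ n ->
  (forall z, eucl_ball r z -> su_polynomial a z != 0) ->
  exists2 w, w \in ws & forall z : 'rV[R[i]]_m,
    (forall k, normc (z 0 k - w * s%:C) <= d) -> normc (su_polynomial a z) <= M.
Proof.
move=> m0 r0 s0 d0 ms md eps0 n0 Dws j00 aA M0 numeric hol.
apply: contrapT => nex.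
have Hw w : w \in ws -> exists z : 'rV[R[i]]_m,
    (forall k, normc (z 0 k - w * s%:C) <= d) /\ M < normc (su_polynomial a z).
  move=> wws; apply: contrapT => nz; apply: nex; exists w => // z zd.
  by rewrite leNgt; apply/negP => h; apply: nz; exists z.
have mR : 0 < m%:R :> R by rewrite ltr0n.
pose v : 'rV[R[i]]_m := const_mx s%:C.
have norm_w w : w \in ws -> normc w = 1 by exact: roots_unity_normc Dws.
have szws := roots_unity_size n0 Dws.
have Hnear w : w \in ws -> M < normc (su_polynomial a (w *: v)) * (1 + eps) ^+ N.
  move=> wws; have [z [zd zM]] := Hw w wws; apply: lt_le_trans zM _.
  have [p szp Hp] := su_polynomial_on_line a (w *: v) (z - w *: v).
  have := @poly_growth_no_zero R p N (eps^-1) 1 szp.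
  rewrite !Hp scale1r scale0r addr0 (addrC (w *: v)) subrK normc1 invrK mul1r.
  apply; first by rewrite invr_gt0.
  move=> t ht; rewrite rootE Hp; apply: hol.
  apply: (@eucl_ball_of_coords _ _ _ (s + normc t * d)) => //.
  - by rewrite addr_ge0 ?mulr_ge0 ?normc_ge0 ?ltW.
  - have h1 : m%:R * (normc t * d) <= r / 2.
      have h2 : normc t * eps <= 1.
        by rewrite -ler_pdivlMr// mul1r ltW.
      have h3 := normc_ge0 t.
      have : normc t * (2 * m%:R * d) <= normc t * (r * eps) by rewrite ler_wpM2l.
      have : normc t * eps * r <= 1 * r by rewrite ler_wpM2r// ltW.
      by lra.
    by rewrite mulrDr; lra.
  - move=> k; rewrite !mxE; apply: le_trans (ler_normcD _ _) _.
    rewrite !normcM norm_w// mul1r normc_real ger0_norm ?(ltW s0)//.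
    by rewrite lerD2l ler_wpM2l ?normc_ge0.
have Hprod : \prod_(w <- ws) normc (su_polynomial a (w *: v)) <= 2 ^+ N * A ^+ n.
  have [p szp Hp] := su_polynomial_on_line a 0 v.
  have Hp' t : p.[t] = su_polynomial a (t *: v) by rewrite Hp add0r.
  under eq_bigr do rewrite -Hp'.
  apply: le_trans (poly_prod_roots_unity szp _ Dws n0) _.
    move=> t ht; rewrite rootE Hp'; apply: hol.
    apply: (@eucl_ball_of_coords _ _ _ s) => //; [exact: ltW|lra|].
    move=> k; rewrite !mxE normcM normc_real ger0_norm ?(ltW s0)//.
    by rewrite ler_piMl ?(ltW s0) ?(ltW ht).
  rewrite ler_wpM2l ?exprn_ge0//; apply: lerXn2r; rewrite ?nnegrE ?normc_ge0//.
    exact: le_trans (normc_ge0 _) aA.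
  rewrite Hp' scale0r (su_polynomial_split a 0 j00) big1 ?addr0// => j jj0.
  have [k hk] : exists k, mexp j k != 0%N.
    apply/existsP; apply: contraNT jj0 => /existsPn h; apply/eqP/mexp_inj => k.
    by rewrite j00; apply/eqP; have := h k; rewrite negbK.
  rewrite /monomial_at (bigD1 k)//= mxE expr0n (negbTE hk) mul0r mulr0//.
move: numeric; apply/negP; rewrite -leNgt.
apply: (@le_trans _ _ (\prod_(w <- ws) (normc (su_polynomial a (w *: v)) * (1 + eps) ^+ N))).
  rewrite -[in leLHS]szws -[leLHS]iter_mulr_1 -count_predT -big_const_seq.
  rewrite big_seq [leRHS]big_seq; apply: ler_prod => w wws.
  by rewrite M0/= ltW// Hnear.
rewrite big_split/= big_const_seq count_predT iter_mulr_1 szws.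
rewrite exprMn mulrA ler_wpM2r// !exprn_ge0// addr_ge0// ltW//.
Qed.

(** * Taylor coefficients as linear forms in the random coefficients *)

Definition polydisc_node (R : realType) m K (om w : R[i]) (s d : R)
    (i : {ffun 'I_m -> 'I_K}) : 'rV[R[i]]_m :=
  \row_a (w * (s%:C + d%:C * om ^+ i a)).

(** The factor to the power [- L] divides the polynomial by [z^L], up to a
    factor of modulus 1, so that the
    variables of exponent [L + l] are treated as those of exponent [l].  In
    this way the radius [d] enters the diagonal coefficients to a power at
    most [m K], and not [m (L + K)]. *)
Definition node_weight (R : realType) m K L (om : R[i]) (s d : R)
    (k i : {ffun 'I_m -> 'I_K}) : R[i] :=
  \prod_(a < m) (K%:R^-1 * om ^- (i a * k a) *
                 (s%:C + d%:C * om ^+ i a) ^- L).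

(** The discrete Cauchy formula in each variable, as a linear form in the
    random coefficients.  On the monomials with exponents from [L] to
    [L + K - 1] it is, up to a factor of modulus [d^|k|], the [k]-th Taylor
    coefficient of [z^(- L) f (z)] at [w (s, .., s)]. *)
Definition taylor_form (R : realType) m N K L (om w : R[i]) (s d : R)
    (k : {ffun 'I_m -> 'I_K}) (j : multiindex m N) : R[i] :=
  (Num.sqrt (mbinom R j))%:C *
  \sum_(i : {ffun 'I_m -> 'I_K}) node_weight L om s d k i *
     monomial_at j (polydisc_node om w s d i).

Lemma taylor_formE (R : realType) m N K L (om w : R[i]) (s d : R)
    (k : {ffun 'I_m -> 'I_K}) (a : multiindex m N -> R[i]) :
  \sum_j taylor_form L om w s d k j * a j =
  \sum_(i : {ffun 'I_m -> 'I_K}) node_weight L om s d k i *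
     su_polynomial a (polydisc_node om w s d i).
Proof.
under eq_bigr do rewrite /taylor_form mulr_sumr mulr_suml.
rewrite exchange_big/=; apply: eq_bigr => i _; rewrite mulr_sumr.
by apply: eq_bigr => j _; ring.
Qed.

(** The sum over the nodes of a product polydisc factorizes. *)
Lemma taylor_form_shift (R : realType) m N K L (om w : R[i]) (s d : R)
    (k l : {ffun 'I_m -> 'I_K}) (j : multiindex m N) :
  (forall a, mexp j a = L + l a)%N ->
  (forall i : 'I_K, s%:C + d%:C * om ^+ i != 0) ->
  taylor_form L om w s d k j =
  (Num.sqrt (mbinom R j))%:C * \prod_(a < m) (w ^+ (L + l a) *
    (K%:R^-1 * \sum_(i < K) om ^- (i * k a) * (s%:C + d%:C * om ^+ i) ^+ l a)).
Proof.
move=> jl nz; rewrite /taylor_form; congr (_ * _).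
transitivity (\prod_(a < m) \sum_(i < K) (K%:R^-1 * om ^- (i * k a) *
    (s%:C + d%:C * om ^+ i) ^- L * (w * (s%:C + d%:C * om ^+ i)) ^+ (L + l a))).
  rewrite bigA_distr_bigA/=; apply: eq_bigr => i _.
  rewrite /node_weight /monomial_at -big_split/=; apply: eq_bigr => a _.
  by rewrite mxE jl.
apply: eq_bigr => a _; rewrite !mulr_sumr; apply: eq_bigr => i _.
rewrite exprMn (exprD (s%:C + d%:C * om ^+ i) L (l a)).
have X1 : (s%:C + d%:C * om ^+ i) ^- L * (s%:C + d%:C * om ^+ i) ^+ L = 1.
  by rewrite mulVf// expf_neq0.
by rewrite -[RHS]mulr1 -X1; ring.
Qed.

Lemma shifted_index m N K L : (m * (L + K) <= N)%N ->
  {J : {ffun 'I_m -> 'I_K} -> multiindex m N |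
    forall k a, mexp (J k) a = (L + k a)%N}.
Proof.
move=> h; have H (k : {ffun 'I_m -> 'I_K}) : (\sum_(a < m) (L + k a) <= N)%N.
  apply: leq_trans h; rewrite -[in leqRHS](card_ord m) -sum_nat_const.
  by apply: leq_sum => a _; rewrite leq_add2l ltnW.
exists (fun k => sval (multiindex_of (H k))) => k a.
by case: multiindex_of => j /= ->.
Qed.

Lemma node_normc_ge (R : realType) (om : R[i]) (s d : R) n :
  0 < s -> 0 <= d -> d <= s / 2 -> normc om = 1 ->
  s / 2 <= normc (s%:C + d%:C * om ^+ n).
Proof.
move=> s0 d0 ds om1.
have := ler_normcB (s%:C + d%:C * om ^+ n) (d%:C * om ^+ n).
rewrite addrK normcM normcX om1 expr1n mulr1 !normc_real !ger0_norm ?(ltW s0)//.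
by lra.
Qed.

(** If [k'] differs from [k] and has at least the same sum, some entry satisfies
    [k_a < k'_a]; after the division by [z^L] there remains a monomial of
    degree [k_a], which has no Taylor coefficient of order [k'_a]. *)
Lemma taylor_form_triangular (R : realType) m N K L (om w : R[i]) (s d : R)
    (J : {ffun 'I_m -> 'I_K} -> multiindex m N) (k k' : {ffun 'I_m -> 'I_K}) :
  0 < s -> 0 <= d -> d <= s / 2 -> normc om = 1 -> K.-primitive_root om ->
  (forall k a, mexp (J k) a = L + k a)%N ->
  k' != k -> (\sum_a k a <= \sum_a k' a)%N ->
  taylor_form L om w s d k' (J k) = 0.
Proof.
move=> s0 d0 ds om1 pr HJ kk' le_kk'.
rewrite (@taylor_form_shift _ _ _ _ _ _ _ _ _ _ k)// => [|i]; last first.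
  rewrite -normc_gt0; apply: lt_le_trans (node_normc_ge _ s0 d0 ds om1).
  by rewrite divr_gt0.
have [a ha] : exists a, (k a < k' a)%N.
  apply/existsP; apply: contraNT kk' => /existsPn h.
  have h' a : (k' a <= k a)%N by rewrite leqNgt.
  have := leqif_sum (fun a (_ : xpredT a) => leqif_eq (h' a)) => -[_].
  rewrite eqn_leq le_kk' leq_sum//= => /esym/forallP h2.
  by apply/eqP/ffunP => a; apply/val_inj/eqP; exact: h2.
rewrite (bigD1 a)//= (discrete_cauchy s%:C d%:C pr)//.
by rewrite leqNgt ha mulr0 mul0r mulr0.
Qed.

(** Up to a factor of modulus 1 the coefficient is the square root of the
    multinomial coefficient of [L + k], at least [p^(m L)], times [d^|k|]. *)
Lemma taylor_form_diag (R : realType) m N K L p (om w : R[i]) (s d : R)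
    (J : {ffun 'I_m -> 'I_K} -> multiindex m N) (k : {ffun 'I_m -> 'I_K}) :
  0 < s -> 0 <= d -> d <= s / 2 -> d <= 1 -> normc om = 1 -> normc w = 1 ->
  K.-primitive_root om -> (0 < p)%N -> (K <= L)%N ->
  (2 * p ^ 2 * L + m * (L + K) <= N)%N ->
  (forall k a, mexp (J k) a = L + k a)%N ->
  p%:R ^+ (m * L) * d ^+ (m * K) <= normc (taylor_form L om w s d k (J k)).
Proof.
move=> s0 d0 ds d1 om1 w1 pr p0 KL LN HJ.
rewrite (@taylor_form_shift _ _ _ _ _ _ _ _ _ _ k)// => [|i]; last first.
  rewrite -normc_gt0; apply: lt_le_trans (node_normc_ge _ s0 d0 ds om1).
  by rewrite divr_gt0.
rewrite normcM normc_real ger0_norm ?sqrtr_ge0// normc_prod.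
have degJ : (mdeg (J k) <= m * (L + K))%N.
  rewrite /mdeg -[in leqRHS](card_ord m) -sum_nat_const.
  by apply: leq_sum => a _; rewrite HJ leq_add2l ltnW.
have degJ' : (m * L <= mdeg (J k))%N.
  rewrite /mdeg -[in leqLHS](card_ord m) -sum_nat_const.
  by apply: leq_sum => a _; rewrite HJ leq_addr.
have p1 : 1 <= p%:R :> R by rewrite ler1n.
apply: ler_pM; rewrite ?exprn_ge0//.
  have hb : p%:R ^+ (2 * mdeg (J k)) <= mbinom R (J k).
    rewrite -natrX; apply: (@mbinom_ge _ _ _ _ _ L) => [a|].
      by rewrite HJ mul2n -addnn leq_add2l (leq_trans _ KL)// ltnW.
    by apply: leq_trans LN; rewrite leq_add2l.
  apply: (@le_trans _ _ (p%:R ^+ mdeg (J k))); first exact: ler_weXn2l.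
  rewrite -[leLHS]ger0_norm ?exprn_ge0// -sqrtr_sqr ler_sqrt ?mbinom_ge0//.
  by rewrite -exprM mulnC.
rewrite mulnC exprM -[in leLHS](card_ord m) -prodr_const.
apply: ler_prod => a _; rewrite exprn_ge0//=.
rewrite (discrete_cauchy s%:C d%:C pr)// leqnn subnn expr0 mul1r binn mulr1n.
rewrite normcM !normcX w1 expr1n mul1r normc_real ger0_norm//.
by apply: ler_wiXn2l => //; rewrite ltnW.
Qed.

(** The weights are averages of products of [z_a^(- L)], and [|z_a| >= s / 2]
    at every node. *)
Lemma taylor_form_bound (R : realType) m N K L (om w : R[i]) (s d M : R)
    (k : {ffun 'I_m -> 'I_K}) (a : multiindex m N -> R[i]) :
  0 < s -> 0 <= d -> d <= s / 2 -> normc om = 1 -> (0 < K)%N -> 0 <= M ->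
  (forall i : {ffun 'I_m -> 'I_K},
     normc (su_polynomial a (polydisc_node om w s d i)) <= M) ->
  normc (\sum_j taylor_form L om w s d k j * a j) <= (2 / s) ^+ (m * L) * M.
Proof.
move=> s0 d0 ds om1 K0 M0 hM; rewrite taylor_formE.
apply: le_trans (ler_normc_sum _ _ _) _.
apply: (@le_trans _ _ (\sum_(i : {ffun 'I_m -> 'I_K})
    \prod_(b < m) (K%:R^-1 * (2 / s) ^+ L) * M)).
  apply: ler_sum => i _; rewrite normcM; apply: ler_pM; rewrite ?normc_ge0//.
  rewrite normc_prod; apply: ler_prod => b _; rewrite normc_ge0/=.
  rewrite !normcM !normcV !normcX om1 expr1n invr1 mulr1.
  have -> : normc (K%:R : R[i]) = K%:R.
    by rewrite -(rmorph_nat (real_complex R)) normc_real ger0_norm.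
  rewrite ler_wpM2l ?invr_ge0// -exprVn; apply: lerXn2r.
  - by rewrite nnegrE invr_ge0 normc_ge0.
  - by rewrite nnegrE divr_ge0// ltW.
  have h := node_normc_ge (i b) s0 d0 ds om1.
  have s2 : 0 < s / 2 by rewrite divr_gt0.
  rewrite -invf_div lef_pV2 ?posrE//; exact: lt_le_trans h.
rewrite sumr_const card_ffun !card_ord -[leLHS]mulr_natl prodr_const card_ord.
rewrite exprMn natrX exprVn mulrA [X in X * _]mulrA mulfV ?mul1r.
  by rewrite -exprM mulnC.
by rewrite expf_neq0// pnatr_eq0 -lt0n.
Qed.

(** * The upper bound *)

Lemma measure_bigsetU_le (R : realType) d (T : measurableType d)
    (P : probability T R) (I : Type) (s : seq I) (E : I -> set T) (x : R) :
  (forall i, measurable (E i)) -> (forall i, P (E i) <= x%:E)%E ->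
  (P (\big[setU/set0]_(i <- s) E i) <= ((size s)%:R * x)%:E)%E.
Proof.
move=> mE PE; elim: s => [|i s IH]; first by rewrite big_nil measure0 mul0r.
rewrite big_cons; apply: le_trans (measureU2 _ _ _) _ => //.
  exact: bigsetU_measurable.
by rewrite /= -natr1 mulrDl mul1r addrC EFinD; exact: leeD.
Qed.

(** Outside the event that the constant coefficient exceeds [A], one of the
    [n] polydiscs carries small values, and then all its Taylor forms are
    small at once. *)
Lemma hole_probability_event_bound (R : realType) m N (r s dl eps A M : R)
    (n p L K : nat) d (T : measurableType d) (P : probability T R)
    (alpha : multiindex m N -> T -> R[i]) :
  iid_standard_complex_gaussian P alpha ->
  (0 < m)%N -> 0 < r -> 0 < s -> 0 < dl -> m%:R * s <= r / 4 ->
  2 * m%:R * dl <= r * eps -> 0 < eps -> (0 < n)%N -> 0 <= A -> 0 <= M ->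
  2 ^+ N * (A * (1 + eps) ^+ N) ^+ n < M ^+ n ->
  dl <= s / 2 -> dl <= 1 -> (0 < p)%N -> (0 < K)%N -> (K <= L)%N ->
  (2 * p ^ 2 * L + m * (L + K) <= N)%N ->
  (P (hole alpha r) <= (2 * expR (- (A ^+ 2 / 2)) +
     n%:R * (4 * ((2 / s) ^+ (m * L) * M /
                  (p%:R ^+ (m * L) * dl ^+ (m * K))) ^+ 2) ^+ (K ^ m))%:E)%E.
Proof.
move=> iid m0 r0 s0 d0 ms md eps0 n0 A0 M0 numeric ds d1 p0 K0 KL LN.
have [gauss _] := iid.
have [ws Dws] := roots_unity_exist R n0.
have [om pr] := prim_root_exists R K0.
have om1 : normc om = 1 by apply: (normc_root1 K0); exact: prim_expr_order.
have [j0 j00] := zero_index m N.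
have szws := roots_unity_size n0 Dws.
have norm_w w : w \in ws -> normc w = 1 by exact: roots_unity_normc Dws.
have [J HJ] : {J : {ffun 'I_m -> 'I_K} -> multiindex m N |
    forall k a, mexp (J k) a = (L + k a)%N}.
  by apply: shifted_index; apply: leq_trans LN; rewrite leq_addl.
set t := (2 / s) ^+ (m * L) * M; set D := p%:R ^+ (m * L) * dl ^+ (m * K).
have t0 : 0 <= t by rewrite mulr_ge0// exprn_ge0// divr_ge0// ltW.
have D0 : 0 < D by rewrite mulr_gt0// exprn_gt0// ltr0n.
pose E0 := [set w | (A <= normc (alpha j0 w))%R]%classic.
pose E w := (\bigcap_(k in [set` [set: {ffun 'I_m -> 'I_K}]%SET])
   [set x | (normc (\sum_j taylor_form L om w s dl k j * alpha j x) <= t)%R])%classic.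
have mE w : measurable (E w).
  apply: fin_bigcap_measurable => // k _; apply: cmeasurable_normc_le.
  apply: cmeasurable_sum => j; apply: cmeasurableM; first exact: cmeasurable_cst.
  exact: gaussian_cmeasurable (gauss j).
have mE0 : measurable E0.
  rewrite (_ : E0 = (fun x => sqnorm (alpha j0 x)) @^-1` `[A ^+ 2, +oo[)%classic.
    rewrite -[X in measurable X]setTI; apply: measurable_sqnorm => //.
    exact: gaussian_cmeasurable (gauss j0).
  apply/seteqP; split => x /=; rewrite in_itv/= andbT /E0/= /sqnorm;
  case: (alpha j0 x) => a b /=;
  by rewrite -[_ <= _ + _](@ler_sqrt R) ?addr_ge0 ?sqr_ge0// sqrtr_sqr ger0_norm.
have PE w : normc w = 1 -> (P (E w) <= ((4 * (t / D) ^+ 2) ^+ (K ^ m))%:E)%E.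
  move=> w1; have := @small_ball_triangular R d T P _ _ alpha J
    (fun k => \sum_a k a)%N (taylor_form L om w s dl) D t iid D0 t0.
  move=> /(_ _ _ [set: {ffun 'I_m -> 'I_K}]%SET).
  rewrite cardsT card_ffun !card_ord; apply.
    by move=> k; exact: (taylor_form_diag k s0 (ltW d0) ds d1 om1 w1 pr p0 KL LN HJ).
  move=> k k' kk' le_kk'.
  exact: (taylor_form_triangular w s0 (ltW d0) ds om1 pr HJ kk' le_kk').
pose E' w := if normc w == 1 then E w else set0.
have mE' w : measurable (E' w) by rewrite /E'; case: ifP.
have PE' w : (P (E' w) <= ((4 * (t / D) ^+ 2) ^+ (K ^ m))%:E)%E.
  rewrite /E'; case: ifP => [/eqP|_]; first exact: PE.
  by rewrite measure0 lee_fin exprn_ge0// mulr_ge0// sqr_ge0.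
have mH : measurable (hole alpha r).
  by apply: measurable_hole => // j; exact: gaussian_cmeasurable (gauss j).
have mU : measurable (\big[setU/set0]_(w <- ws) E' w) by exact: bigsetU_measurable.
have sub : (hole alpha r `<=` E0 `|` \big[setU/set0]_(w <- ws) E' w)%classic.
  move=> x Hx; have [hA|hA] := leP A (normc (alpha j0 x)); first by left.
  right; have [w wws hw] := hole_forces_small_polydisc m0 r0 s0 d0 ms md eps0 n0
    Dws j00 (ltW hA) M0 numeric Hx.
  rewrite -bigcup_seq; exists w => //.
  rewrite /E' norm_w// eqxx => k _ /=.
  apply: taylor_form_bound => //; first exact: ltW.
  move=> i; apply: hw => a; rewrite mxE mulrDr addrC addKr.
  rewrite !normcM normcX om1 expr1n mulr1 norm_w// mul1r normc_real.
  by rewrite ger0_norm// ltW.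
apply: le_trans (le_measure _ (mem_set mH) (mem_set (measurableU _ _ mE0 mU)) sub) _.
apply: le_trans (measureU2 _ mE0 mU) _.
rewrite EFinD; apply: leeD; first exact: gaussian_tail.
by rewrite -szws; exact: measure_bigsetU_le.
Qed.

Lemma nat_above (R : realType) (x : R) : {n : nat | (0 < n)%N & x <= n%:R}.
Proof.
exists (Num.Def.archi_bound `|x|).+1 => //.
apply: le_trans (ler_norm x) _; apply: le_trans (ltW (archi_boundP (normr_ge0 x))) _.
by rewrite ler_nat.
Qed.

Lemma expR_dominates_pow (R : realType) (beta C : R) k : 0 < beta ->
  exists N0 : nat, forall N : nat, (N0 < N)%N -> C * N%:R ^+ k <= expR (beta * N%:R).
Proof.
move=> b0; pose g := (beta / k.+1%:R) ^+ k.+1.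
have g0 : 0 < g by rewrite exprn_gt0// divr_gt0.
have [N0 _ hN0] := nat_above (C / g); exists N0 => N NN.
have hN : C <= g * N%:R.
  rewrite mulrC -ler_pdivrMr//; apply: le_trans hN0 _.
  by rewrite ler_nat ltnW.
apply: (@le_trans _ _ ((beta / k.+1%:R * N%:R) ^+ k.+1)).
  by rewrite exprMn (exprS N%:R) mulrA ler_wpM2r// exprn_ge0.
have -> : beta * N%:R = beta / k.+1%:R * N%:R * k.+1%:R.
  by rewrite mulrAC divfK// pnatr_eq0.
rewrite expRM_natr; apply: lerXn2r; rewrite ?nnegrE ?expR_ge0//.
  by rewrite mulr_ge0// divr_ge0// ltW.
by apply: le_trans (expR_ge1Dx _); rewrite lerDr.
Qed.

Lemma expRN_le (R : realType) (a x : R) : 0 < x -> x^-1 <= a -> expR (- a) <= x.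
Proof.
move=> x0 xa; rewrite expRN -[leRHS]invrK lef_pV2 ?posrE ?expR_gt0 ?invr_gt0//.
by apply: le_trans xa _; apply: le_trans (expR_ge1Dx _); rewrite lerDr.
Qed.

(** The choice of [p] makes [(2 / s)^(m L)] smaller than [p^(m L)] by the factor
    [exp (- 4 m L)]; the size [exp (N / q)] of the polynomial and the radius
    [exp (- a)] of the polydisc lose at most [exp (L + 1 + m L)]. *)
Lemma small_ball_ratio (R : realType) (m p L K q a N : nat) (s : R) :
  (0 < m)%N -> 0 < s -> (0 < p)%N -> 2 / s * expR 4 <= p%:R -> (0 < q)%N ->
  (N <= q * L.+1)%N -> (a * K <= L)%N -> (0 < L)%N ->
  (2 / s) ^+ (m * L) * expR (N%:R / q%:R) /
    (p%:R ^+ (m * L) * expR (- a%:R) ^+ (m * K)) <= expR (- L%:R).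
Proof.
move=> m0 s0 p0 hp q0 NL aK L0.
have pR : 0 < p%:R :> R by rewrite ltr0n.
have -> : (2 / s) ^+ (m * L) * expR (N%:R / q%:R) /
    (p%:R ^+ (m * L) * expR (- a%:R) ^+ (m * K)) =
  (2 / s / p%:R) ^+ (m * L) * expR (N%:R / q%:R + (a * (m * K))%:R).
  rewrite invfM -expRM_natr mulNr expRN invrK expRD (natrM _ a).
  by rewrite [in RHS]exprMn exprVn; ring.
apply: (@le_trans _ _ (expR (- 4) ^+ (m * L) * expR (L%:R + 1 + (m * L)%:R))).
  apply: ler_pM; rewrite ?expR_ge0 ?exprn_ge0 ?divr_ge0 ?(ltW s0)//.
    apply: lerXn2r; rewrite ?nnegrE ?expR_ge0 ?divr_ge0 ?(ltW s0)//.
    rewrite ler_pdivrMr// expRN ler_pdivlMl ?expR_gt0//.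
    by rewrite mulrC.
  rewrite ler_expR; apply: lerD.
    by rewrite ler_pdivrMr ?ltr0n// natr1 -natrM ler_nat mulnC.
  by rewrite ler_nat mulnCA leq_mul2l aK orbT.
rewrite -expRM_natr -expRD ler_expR natrM.
have L1 : 1 <= L%:R :> R by rewrite ler1n.
have m1 : 1 <= m%:R :> R by rewrite ler1n.
nra.
Qed.

(** With [M = exp (N / q)], each of the three losses, [2^N] shared between the
    [3 q] vertices, the constant coefficient [M^(1/3)] and the displacement
    [(1 + 1 / (3 q))^N], uses a third of the exponent; strictness comes from
    [2 < exp 1]. *)
Lemma polygon_numeric (R : realType) (q N : nat) : (0 < q)%N -> (0 < N)%N ->
  2 ^+ N * (expR (N%:R / (3 * q)%:R) * (1 + (3 * q)%:R^-1) ^+ N) ^+ (3 * q) <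
  expR (N%:R / q%:R) ^+ (3 * q) :> R.
Proof.
move=> q0 N0; have qR : 0 < q%:R :> R by rewrite ltr0n.
have q3 : 0 < (3 * q)%:R :> R by rewrite ltr0n muln_gt0.
have E1 : expR (N%:R / q%:R) ^+ (3 * q) = expR 1 ^+ N * (expR 1 ^+ N) ^+ 2 :> R.
  rewrite -exprM -exprD -!expRM_natr mul1r; congr expR.
  by rewrite !natrM natrD natrM; field; rewrite gt_eqF.
have E2 : (expR (N%:R / (3 * q)%:R) * (1 + (3 * q)%:R^-1) ^+ N) ^+ (3 * q) <=
    (expR 1 ^+ N) ^+ 2 :> R.
  have -> : (expR 1 ^+ N) ^+ 2 =
      (expR (N%:R / (3 * q)%:R) * expR ((3 * q)%:R^-1) ^+ N) ^+ (3 * q) :> R.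
    rewrite -!expRM_natr -expRD -expRM_natr mul1r; congr expR.
    by rewrite !natrM; field; rewrite gt_eqF.
  have h0 : 0 <= 1 + (3 * q)%:R^-1 :> R by rewrite addr_ge0// invr_ge0.
  apply: lerXn2r; rewrite ?nnegrE ?mulr_ge0 ?expR_ge0 ?exprn_ge0 ?expR_ge0//.
  rewrite ler_wpM2l ?expR_ge0//; apply: lerXn2r; rewrite ?nnegrE ?expR_ge0//.
  exact: expR_ge1Dx.
rewrite E1; apply: (@le_lt_trans _ _ (2 ^+ N * (expR 1 ^+ N) ^+ 2)).
  by rewrite ler_wpM2l// exprn_ge0.
rewrite ltr_pM2r ?exprn_gt0 ?expR_gt0//.
rewrite ltrXn2r ?expR_ge0 -?lt0n//.
by have := @expR_gt1Dx R 1 (oner_neq0 _); lra.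
Qed.

(** [L] and [K] are fixed fractions of [N], up to rounding: the random
    coefficients used have multi-indices with entries from [L] to
    [L + K - 1], small enough for the lower bound on their multinomial
    coefficients. *)
Lemma block_sizes (m p a N : nat) : (0 < p)%N -> (m <= p)%N -> (0 < a)%N ->
  (3 * (4 * p ^ 2 * a) <= N)%N ->
  exists L K : nat, [/\ [/\ (3 <= L)%N, (0 < K)%N & (K <= L)%N],
    (N <= 4 * p ^ 2 * L.+1)%N, (a * K <= L)%N,
    (2 * p ^ 2 * L + m * (L + K) <= N)%N &
    (N <= 2 * (4 * p ^ 2) * L)%N /\ (N <= 4 * (4 * p ^ 2) * a * K)%N].
Proof.
move=> p0 mp a0 NN; have mp2 : (m <= p ^ 2)%N.
  by apply: leq_trans mp _; rewrite expnS expn1 leq_pmulr.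
have p20 : (0 < p ^ 2)%N by rewrite expn_gt0 p0.
move: (p ^ 2)%N mp2 p20 NN => p2 mp2 p20 NN {p0 mp}.
have q0 : (0 < 4 * p2)%N by rewrite muln_gt0.
have qLN := leq_trunc_div N (4 * p2); have NqL := ltn_ceil N q0.
have L3 : (3 * a <= N %/ (4 * p2))%N by rewrite leq_divRL// -mulnA (mulnC a).
set L := (N %/ (4 * p2))%N in qLN NqL L3.
have aKL := leq_trunc_div L a; have LaK := ltn_ceil L a0.
have K3 : (3 <= L %/ a)%N by rewrite leq_divRL.
set K := (L %/ a)%N in aKL LaK K3.
have KL : (K <= L)%N by apply: leq_trans aKL; rewrite leq_pmulr.
exists L, K; split; [split|rewrite mulnC; exact: ltnW|by rewrite mulnC| |split].
- by apply: leq_trans L3; rewrite leq_pmulr.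
- exact: leq_trans K3.
- exact: KL.
- have h : (m * (L + K) <= p2 * (L + L))%N by rewrite leq_mul// leq_add2l.
  apply: leq_trans qLN; apply: (@leq_trans (2 * p2 * L + p2 * (L + L))).
    by rewrite leq_add2l.
  by rewrite mulnDr; lia.
- apply: leq_trans (ltnW NqL) _.
  by rewrite mulnAC leq_mul2r; apply/orP; right; lia.
- have h : (L.+1 <= 4 * (a * K))%N by move: LaK; rewrite mulnC mulnS; lia.
  apply: leq_trans (ltnW NqL) _; rewrite mulnC.
  rewrite [X in (_ <= X)%N](_ : _ = 4 * p2 * (4 * (a * K)))%N; last by lia.
  by rewrite leq_mul2l h orbT.
Qed.

(** The tail of the constant coefficient is doubly exponential, so both events
    are bounded by [exp (- c' N^(m+1))]; passing from [c'] to [c' / 2] absorbs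
    the number [3 q + 2] of terms. *)
Lemma hole_probability_upper (R : realType) m (r : R) : (0 < m)%N -> 0 < r ->
  exists (c : R) (N0 : nat), 0 < c /\
    forall N : nat, (N0 < N)%N ->
    forall (d : measure_display) (T : measurableType d) (P : probability T R)
      (alpha : multiindex m N -> T -> R[i]),
    iid_standard_complex_gaussian P alpha ->
    (P (hole alpha r) <= (expR (- (c * N%:R ^+ m.+1)))%:E)%E.
Proof.
move=> m0 r0.
have mR : 0 < m%:R :> R by rewrite ltr0n.
pose s : R := r / (4 * m%:R).
have s0 : 0 < s by rewrite divr_gt0// mulr_gt0.
(* The multinomial coefficients used are at least [p^(2 m L)] when
   [N >= 4 p^2 L]; their square roots outweigh [(2 / s)^(m L)] by
   [exp (4 m L)]. *)
have [p p0 hp] : {p : nat | (0 < p)%N & Num.max (2 / s * expR 4) m%:R <= p%:R :> R}.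
  exact: nat_above.
have [hp1 mp] : 2 / s * expR 4 <= p%:R /\ (m <= p)%N.
  by move: hp; rewrite ge_max ler_nat => /andP[].
pose q := (4 * p ^ 2)%N.
have q0 : (0 < q)%N by rewrite muln_gt0 expn_gt0 p0.
have qR : 0 < q%:R :> R by rewrite ltr0n.
pose eps : R := (3 * q)%:R^-1.
have eps0 : 0 < eps by rewrite invr_gt0 ltr0n muln_gt0.
have s2 : 0 < s / 2 by rewrite divr_gt0.
have re : 0 < r * eps / (2 * m%:R) by rewrite !mulr_gt0// invr_gt0 mulr_gt0.
(* The polydisc radius is [exp (- a)], so that its powers compare with the
   exponentials in [L]. *)
have [a a0 ha] : {a : nat | (0 < a)%N &
    Num.max (s / 2)^-1 (r * eps / (2 * m%:R))^-1 <= a%:R :> R}.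
  exact: nat_above.
have [ha1 ha2] : (s / 2)^-1 <= a%:R /\ (r * eps / (2 * m%:R))^-1 <= a%:R.
  by move: ha; rewrite ge_max => /andP[].
have aR : 0 < a%:R :> R by rewrite ltr0n.
pose dl : R := expR (- a%:R).
have dl0 : 0 < dl by exact: expR_gt0.
have dls : dl <= s / 2 by exact: expRN_le.
have dle : 2 * m%:R * dl <= r * eps.
  have h : dl <= r * eps / (2 * m%:R) by exact: expRN_le.
  by rewrite mulrC -ler_pdivlMr// mulr_gt0.
have dl1 : dl <= 1 by rewrite /dl expRN invf_le1 ?expR_gt0// -[leLHS]expR0 ler_expR ltW.
(* [L >= N / (2 q)] and [K >= N / (4 q a)]. *)
pose c' : R := (2 * q%:R)^-1 * ((4 * q%:R * a%:R)^-1) ^+ m.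
have c'0 : 0 < c'.
  by rewrite mulr_gt0 ?exprn_gt0 ?invr_gt0 ?mulr_gt0.
have b0 : 0 < 2 / (3 * q)%:R :> R by rewrite divr_gt0// ltr0n muln_gt0.
have [N1 hN1] := expR_dominates_pow (2 * c') m.+1 b0.
have c'2 : 0 < c' / 2 by rewrite divr_gt0.
have [N2 hN2] := expR_dominates_pow (3 * q + 2)%:R 0 c'2.
exists (c' / 2), (3 * (q * a) + N1 + N2)%N; split => // N NN d T P alpha iid.
have N12 : [/\ (3 * (q * a) <= N)%N, (N1 < N)%N & (N2 < N)%N].
  split; last by rewrite (leq_ltn_trans _ NN)// leq_addl.
    by rewrite (leq_trans _ (ltnW NN))// -addnA leq_addr.
  by rewrite (leq_ltn_trans _ NN)// addnAC leq_addl.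
have [qaN NN1 NN2] := N12.
have N0 : (0 < N)%N by exact: leq_ltn_trans NN.
have NR : 0 < N%:R :> R by rewrite ltr0n.
have [L [K [[L3 K0 KL] NqL aKL LN [NL NK]]]] := block_sizes p0 mp a0 qaN.
have n0 : (0 < 3 * q)%N by rewrite muln_gt0.
have ms : m%:R * s <= r / 4.
  rewrite /s le_eqVlt; apply/orP; left; apply/eqP; field; exact: lt0r_neq0.
have := @hole_probability_event_bound R m N r s dl eps (expR (N%:R / (3 * q)%:R))
  (expR (N%:R / q%:R)) (3 * q) p L K d T P alpha iid m0 r0 s0 dl0 ms dle eps0 n0
  (expR_ge0 _) (expR_ge0 _) (polygon_numeric R q0 N0) dls dl1 p0 K0 KL LN.
move=> /le_trans; apply; rewrite lee_fin.
have L0 : (0 < L)%N by exact: leq_trans L3.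
set x := (X in 4 * X ^+ 2).
have hx : x <= expR (- L%:R) by apply: small_ball_ratio.
have x0 : 0 <= x.
  by rewrite divr_ge0 ?mulr_ge0 ?exprn_ge0 ?expR_ge0 ?divr_ge0// ltW.
have hx2 : 4 * x ^+ 2 <= expR (- L%:R).
  apply: (@le_trans _ _ (4 * (expR (- L%:R) * expR (- L%:R)))).
    by rewrite ler_wpM2l// expr2 ler_pM.
  rewrite mulrA ler_piMl ?expR_ge0// expRN ler_pdivrMr ?expR_gt0// mul1r.
  apply: le_trans (expR_ge1Dx _); rewrite -(natr1 3) addrC lerD2l ler_nat.
  exact: L3.
have LK : c' * N%:R ^+ m.+1 <= L%:R * (K ^ m)%:R.
  have hL : (2 * q%:R)^-1 * N%:R <= L%:R :> R.
    by rewrite ler_pdivrMl ?mulr_gt0// -!natrM ler_nat.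
  have hK : (4 * q%:R * a%:R)^-1 * N%:R <= K%:R :> R.
    by rewrite ler_pdivrMl ?mulr_gt0// -!natrM ler_nat.
  rewrite /c' exprS natrX mulrACA -exprMn.
  apply: ler_pM => //; rewrite ?mulr_ge0 ?exprn_ge0 ?mulr_ge0 ?invr_ge0 ?mulr_ge0//.
  by apply: lerXn2r; rewrite ?nnegrE// mulr_ge0// invr_ge0 !mulr_ge0.
have hsecond : (4 * x ^+ 2) ^+ (K ^ m) <= expR (- (c' * N%:R ^+ m.+1)).
  apply: (@le_trans _ _ (expR (- L%:R) ^+ (K ^ m))).
    by apply: lerXn2r; rewrite ?nnegrE ?expR_ge0// mulr_ge0// sqr_ge0.
  by rewrite -expRM_natr ler_expR mulNr lerN2.
have hfirst : expR (- (expR (N%:R / (3 * q)%:R) ^+ 2 / 2)) <=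
    expR (- (c' * N%:R ^+ m.+1)).
  rewrite ler_expR lerN2 ler_pdivlMr// -expRM_natr.
  have -> : N%:R / (3 * q)%:R * 2%:R = 2 / (3 * q)%:R * N%:R :> R.
    by rewrite mulrC mulrA mulrAC.
  by rewrite mulrAC (mulrC c'); exact: hN1.
set y := expR (- (c' * N%:R ^+ m.+1)).
apply: (@le_trans _ _ ((3 * q + 2)%:R * y)).
  rewrite (natrD _ (3 * q) 2) (mulrDl _ _ y) addrC; apply: lerD; rewrite ler_wpM2l//.
have := hN2 N NN2.
rewrite expr0 mulr1 => h.
apply: (@le_trans _ _ (expR (c' / 2 * N%:R ^+ m.+1) * y)).
  rewrite ler_wpM2r ?expR_ge0//; apply: le_trans h _; rewrite ler_expR.
  by rewrite ler_wpM2l ?(ltW c'2)// exprS ler_peMr// exprn_ege1// ler1n.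
by rewrite /y -expRD ler_expR; lra.
Qed.

Theorem theorem2 (R : realType) (m : nat) (hm : (1 <= m)%N) (r : R)
    (hr : 0 < r) :
  exists (c1 c2 : R) (N0 : nat),
    [/\ 0 < c1, 0 < c2 &
      forall N : nat, (N0 < N)%N ->
      forall (d : measure_display) (T : measurableType d)
        (P : probability T R) (alpha : multiindex m N -> T -> R[i]),
        iid_standard_complex_gaussian P alpha ->
        ((expR (- (c2 * N%:R ^+ m.+1)))%:E <= P (hole alpha r))%E /\
        (P (hole alpha r) <= (expR (- (c1 * N%:R ^+ m.+1)))%:E)%E ].
Proof.
have [c1 [N0 [c10 Hup]]] := hole_probability_upper hm hr.
exists c1, ((12 + 2 * (4 ^+ m * (1 + r))) * 2 ^+ m), N0; split => //.
  have h : 0 < 4 ^+ m * (1 + r) by rewrite mulr_gt0 ?exprn_gt0// addr_gt0.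
  by rewrite mulr_gt0 ?exprn_gt0//; lra.
move=> N NN d T P alpha iid; split; last exact: Hup.
by apply: hole_probability_lower => //; apply: leq_ltn_trans NN.
Qed.
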